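(* On $\mathbb R^8$ with coordinates $(x_1,\dots,x_4,y_1,\dots,y_4)$ consider the Riemannian metrics $$g_1=\sum_{i=1}^4 dx_i^2+\Big(dy_1-\tfrac12(x_1dx_2-x_2dx_1-x_3dx_4+x_4dx_3)\Big)^2+\sum_{j=2}^4dy_j^2,$$ $$g_2=\sum_{i=1}^4 dx_i^2+dy_1^2+\Big(dy_2-\tfrac12(x_1dx_3-x_3dx_1+x_2dx_4-x_4dx_2)\Big)^2+\Big(dy_3-\tfrac12(x_1dx_4-x_4dx_1-x_2dx_3+x_3dx_2)\Big)^2+dy_4^2,$$ $$g_3=\sum_{i=1}^4 dx_i^2+\Big(dy_1-\tfrac12(x_1dx_2-x_2dx_1-x_3dx_4+x_4dx_3)\Big)^2+\Big(dy_2-\tfrac12(x_1dx_3-x_3dx_1+x_2dx_4-x_4dx_2)\Big)^2+\Big(dy_3-\tfrac12(x_1dx_4-x_4dx_1-x_2dx_3+x_3dx_2)\Big)^2+dy_4^2.$$ Then each $g_i$ ($i=1,2,3$) is the metric of a weak HKT structure on $\mathbb R^8$; each $g_i$ has a transitive nilpotent group of isometries, and hence is complete; and $g_1,g_2,g_3$ are pairwise non-isometric.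
   Context: A hypercomplex structure on a manifold $M$ is a triple of integrable complex structures $\{J_i\}_{i=1,2,3}$ with $J_1J_2=-J_2J_1=J_3$. A hyperhermitian manifold $(M,\{J_i\}_{i=1,2,3},g)$ (i.e. $g$ is Hermitian with respect to each $J_i$) is HKT if there is a connection $\nabla$ with $\nabla g=0$, $\nabla J_i=0$ for $i=1,2,3$, and such that $c(X,Y,Z)=g(X,T(Y,Z))$ is a 3-form, where $T$ is the torsion of $\nabla$; such a connection is unique. The HKT structure is called weak if $dc\neq0$. *)

(* Defs.v *)
From HB Require Import structures.
From mathcomp Require Import all_boot all_order all_algebra.
From mathcomp Require Import all_classical all_reals all_analysis.
Set Implicit Arguments.
Unset Strict Implicit.
Unset Printing Implicit Defensive.
Import Order.TTheory GRing.Theory Num.Theory.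
Import numFieldNormedType.Exports.
Local Open Scope classical_set_scope.
Local Open Scope ring_scope.

Section Smooth.
Context {R : realType} {V W : normedModType R}.

Fixpoint Ck (k : nat) (f : V -> W) : Prop :=
  if k is j.+1 then
    (forall p, differentiable f p) /\ (forall v, Ck j (fun p => 'D_v f p))
  else continuous f.

Definition smooth (f : V -> W) : Prop := forall k, Ck k f.

End Smooth.

(* The manifold is R^(n.+1) with its single global chart, so a vector field is
   a map V -> V, an endomorphism field or a (0,2)-tensor field is a map
   V -> 'M_n.+1, and a metric g p acts by v, w |-> v^T *m g p *m w.  Vectors
   are columns, so that the composition of endomorphisms is *m. *)
Section Geometry.
Context {R : realType} {n : nat}.
Local Notation V := 'cV[R]_n.+1.
Local Notation M := 'M[R]_n.+1.

Implicit Types (X Y Z : V -> V) (f : V -> R) (g : V -> M) (J : V -> M).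

Definition pairing (A : M) (v w : V) : R := (v^T *m A *m w) 0 0.

Definition lie_deriv X f : V -> R := fun p => 'D_(X p) f p.

Definition bracket X Y : V -> V := fun p => 'D_(X p) Y p - 'D_(Y p) X p.

Definition app J X : V -> V := fun p => J p *m X p.

Definition inner g X Y : V -> R := fun p => pairing (g p) (X p) (Y p).

Definition riemannian g : Prop :=
  [/\ smooth g, forall p, (g p)^T = g p
    & forall p v, v != 0 -> 0 < pairing (g p) v v].

Definition nijenhuis J X Y : V -> V := fun p =>
  bracket (app J X) (app J Y) p - app J (bracket (app J X) Y) p
  - app J (bracket X (app J Y)) p - bracket X Y p.

Definition complex_structure J : Prop :=
  [/\ smooth J, forall p, J p *m J p = - 1%:M
    & forall X Y, smooth X -> smooth Y -> forall p, nijenhuis J X Y p = 0].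

Definition hypercomplex (J1 J2 J3 : V -> M) : Prop :=
  [/\ complex_structure J1, complex_structure J2, complex_structure J3,
      forall p, J1 p *m J2 p = - (J2 p *m J1 p)
    & forall p, J1 p *m J2 p = J3 p].

Definition hermitian J g : Prop :=
  forall p v w, pairing (g p) (J p *m v) (J p *m w) = pairing (g p) v w.

Definition hyperhermitian (J1 J2 J3 g : V -> M) : Prop :=
  [/\ hypercomplex J1 J2 J3, riemannian g
    & [/\ hermitian J1 g, hermitian J2 g & hermitian J3 g]].

(* nabla X Y stands for the covariant derivative of Y along X; its values on
   maps that are not smooth are irrelevant. *)
Definition connection (nabla : (V -> V) -> (V -> V) -> (V -> V)) : Prop :=
  [/\ forall X Y, smooth X -> smooth Y -> smooth (nabla X Y),
      forall X Y Z, smooth X -> smooth Y -> smooth Z ->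
        forall p, nabla (X \+ Y) Z p = nabla X Z p + nabla Y Z p,
      forall f X Y, smooth f -> smooth X -> smooth Y ->
        forall p, nabla (fun q => f q *: X q) Y p = f p *: nabla X Y p,
      forall X Y Z, smooth X -> smooth Y -> smooth Z ->
        forall p, nabla X (Y \+ Z) p = nabla X Y p + nabla X Z p
    & forall f X Y, smooth f -> smooth X -> smooth Y ->
        forall p, nabla X (fun q => f q *: Y q) p
                  = lie_deriv X f p *: Y p + f p *: nabla X Y p].

Definition torsion (nabla : (V -> V) -> (V -> V) -> (V -> V)) X Y : V -> V :=
  fun p => nabla X Y p - nabla Y X p - bracket X Y p.

Definition metric_connection (nabla : (V -> V) -> (V -> V) -> (V -> V)) g :=
  forall X Y Z, smooth X -> smooth Y -> smooth Z ->
    forall p, lie_deriv X (inner g Y Z) p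
              = inner g (nabla X Y) Z p + inner g Y (nabla X Z) p.

Definition parallel_endo (nabla : (V -> V) -> (V -> V) -> (V -> V)) J :=
  forall X Y, smooth X -> smooth Y ->
    forall p, nabla X (app J Y) p = app J (nabla X Y) p.

(* Linearity in the other two arguments follows from alternation. *)
Definition three_form (c : (V -> V) -> (V -> V) -> (V -> V) -> (V -> R)) :=
  [/\ forall X Y Z, smooth X -> smooth Y -> smooth Z -> smooth (c X Y Z),
      forall X X' Y Z, smooth X -> smooth X' -> smooth Y -> smooth Z ->
        forall p, c (X \+ X') Y Z p = c X Y Z p + c X' Y Z p,
      forall f X Y Z, smooth f -> smooth X -> smooth Y -> smooth Z ->
        forall p, c (fun q => f q *: X q) Y Z p = f p * c X Y Z p,
      forall X Y Z, smooth X -> smooth Y -> smooth Z ->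
        forall p, c Y X Z p = - c X Y Z p
    & forall X Y Z, smooth X -> smooth Y -> smooth Z ->
        forall p, c X Z Y p = - c X Y Z p].

(* The exterior derivative of a 3-form, by the invariant (Cartan) formula. *)
Definition ext_deriv (c : (V -> V) -> (V -> V) -> (V -> V) -> (V -> R))
    X0 X1 X2 X3 : V -> R := fun p =>
  lie_deriv X0 (c X1 X2 X3) p - lie_deriv X1 (c X0 X2 X3) p
  + lie_deriv X2 (c X0 X1 X3) p - lie_deriv X3 (c X0 X1 X2) p
  - c (bracket X0 X1) X2 X3 p + c (bracket X0 X2) X1 X3 p
  - c (bracket X0 X3) X1 X2 p - c (bracket X1 X2) X0 X3 p
  + c (bracket X1 X3) X0 X2 p - c (bracket X2 X3) X0 X1 p.

Definition torsion_form (nabla : (V -> V) -> (V -> V) -> (V -> V)) g X Y Z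
  : V -> R := inner g X (torsion nabla Y Z).

Definition HKT_connection (J1 J2 J3 g : V -> M)
    (nabla : (V -> V) -> (V -> V) -> (V -> V)) : Prop :=
  [/\ connection nabla, metric_connection nabla g,
      [/\ parallel_endo nabla J1, parallel_endo nabla J2
        & parallel_endo nabla J3]
    & three_form (torsion_form nabla g)].

Definition weak_HKT (J1 J2 J3 g : V -> M) : Prop :=
  hyperhermitian J1 J2 J3 g /\
  exists nabla, HKT_connection J1 J2 J3 g nabla /\
    exists X0 X1 X2 X3 : V -> V,
      [/\ smooth X0, smooth X1, smooth X2, smooth X3
        & exists p, ext_deriv (torsion_form nabla g) X0 X1 X2 X3 p != 0].

Definition riem_isometry (g g' : V -> M) (phi : V -> V) : Prop :=
  [/\ smooth phi,
      exists psi : V -> V, [/\ smooth psi, cancel phi psi & cancel psi phi]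
    & forall p v w,
        pairing (g' (phi p)) ('d phi p v) ('d phi p w) = pairing (g p) v w].

Definition isometric (g g' : V -> M) : Prop := exists phi, riem_isometry g g' phi.

(* Lengths of piecewise smooth curves from p to q: each piece is parametrized
   by [0, 1] and is the restriction of a smooth curve defined on R. *)
Definition segment_length g (gamma : R -> V) : R :=
  \int[lebesgue_measure]_(t in `[0, 1]%classic)
    Num.sqrt (pairing (g (gamma t)) (derive1 gamma t) (derive1 gamma t)).

Inductive path_length g : V -> V -> R -> Prop :=
| path_nil p : path_length g p p 0
| path_cons (gamma : R -> V) q l :
    smooth gamma -> path_length g (gamma 1) q l ->
    path_length g (gamma 0) q (segment_length g gamma + l).

Definition riem_dist g (p q : V) : R := inf [set l | path_length g p q l].

Definition complete_metric g : Prop :=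
  forall u : nat -> V,
    (forall e : R, 0 < e -> exists N, forall i j, (N <= i)%N -> (N <= j)%N ->
       riem_dist g (u i) (u j) < e) ->
    exists p, forall e : R, 0 < e -> exists N, forall i, (N <= i)%N ->
       riem_dist g (u i) p < e.

End Geometry.

Section NilpotentGroup.
Variable G : groupType.
Local Open Scope group_scope.

Inductive generated (S : set G) : set G :=
| generated1 : generated S 1
| generated_in x : S x -> generated S x
| generatedM x y : generated S x -> generated S y -> generated S (x * y)
| generatedV x : generated S x -> generated S x^-1.

Fixpoint lower_central (k : nat) : set G :=
  if k is j.+1 then
    generated [set z | exists x y, lower_central j x /\ z = commg x y]
  else setT.

Definition nilpotent_group : Prop :=
  exists k, forall x, lower_central k x -> x = 1.

End NilpotentGroup.

(* A group of isometries is given as an abstract group acting faithfully. *)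
Definition has_transitive_nilpotent_isometries {R : realType} {n : nat}
    (g : 'cV[R]_n.+1 -> 'M[R]_n.+1) : Prop :=
  exists (G : groupType) (act : G -> 'cV[R]_n.+1 -> 'cV[R]_n.+1),
    [/\ nilpotent_group G,
        [/\ forall a b p, act (a * b)%g p = act a (act b p)
          , forall p, act 1%g p = p
          & forall a b, (forall p, act a p = act b p) -> a = b],
        forall a, riem_isometry g g (act a)
      & forall p q, exists a, act a p = q].

(* Coordinates on R^8: x_1, .., x_4 have indices 0, .., 3 and y_1, .., y_4
   have indices 4, .., 7.  A 1-form is a map to row vectors. *)
Section Metrics.
Context {R : realType}.
Local Notation V := 'cV[R]_8.

Definition x_ (i : nat) (p : V) : R := p (inord i.-1) 0.

Definition dx (i : nat) : 'rV[R]_8 := delta_mx 0 (inord i.-1).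
Definition dy (j : nat) : 'rV[R]_8 := delta_mx 0 (inord (j + 3)).

(* The (0,2)-tensor w^2, that is, v, v' |-> w(v) w(v'). *)
Definition sq (w : 'rV[R]_8) : 'M[R]_8 := w^T *m w.

Definition alpha1 (p : V) : 'rV[R]_8 :=
  x_ 1 p *: dx 2 - x_ 2 p *: dx 1 - x_ 3 p *: dx 4 + x_ 4 p *: dx 3.
Definition alpha2 (p : V) : 'rV[R]_8 :=
  x_ 1 p *: dx 3 - x_ 3 p *: dx 1 + x_ 2 p *: dx 4 - x_ 4 p *: dx 2.
Definition alpha3 (p : V) : 'rV[R]_8 :=
  x_ 1 p *: dx 4 - x_ 4 p *: dx 1 - x_ 2 p *: dx 3 + x_ 3 p *: dx 2.

Definition g1 (p : V) : 'M[R]_8 :=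
  \sum_(1 <= i < 5) sq (dx i) + sq (dy 1 - 2^-1 *: alpha1 p)
  + \sum_(2 <= j < 5) sq (dy j).

Definition g2 (p : V) : 'M[R]_8 :=
  \sum_(1 <= i < 5) sq (dx i) + sq (dy 1) + sq (dy 2 - 2^-1 *: alpha2 p)
  + sq (dy 3 - 2^-1 *: alpha3 p) + sq (dy 4).

Definition g3 (p : V) : 'M[R]_8 :=
  \sum_(1 <= i < 5) sq (dx i) + sq (dy 1 - 2^-1 *: alpha1 p)
  + sq (dy 2 - 2^-1 *: alpha2 p) + sq (dy 3 - 2^-1 *: alpha3 p) + sq (dy 4).

End Metrics.

(* Main.v *)
Require Import Defs.
From HB Require Import structures.
From mathcomp Require Import all_boot all_order all_algebra.
From mathcomp Require Import all_classical all_reals all_analysis.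
From mathcomp Require Import ring lra zify.
Import Order.TTheory GRing.Theory Num.Theory.
Import numFieldNormedType.Exports.
Set Implicit Arguments.
Unset Strict Implicit.
Unset Printing Implicit Defensive.
Local Open Scope classical_set_scope.
Local Open Scope ring_scope.

(** Each metric is a left-invariant metric on a two-step nilpotent Lie group,
    written in exponential coordinates.  If [[p, q] = ad p *m q] is the bracket,
    the product is [a + p + [a, p] / 2], the matrix [1 - ad p / 2] is a
    left-invariant coframe, and the metric is the sum of the squares of its rows
    ([metric_twistE]).  Left translations are therefore a transitive nilpotent
    group of isometries ([transitive_metric]).

    HKT structure.  The forms [d alpha_k] are anti-self-dual on the [x]-space,
    so they are invariant under the complex structures of the quaternions, and
    the left-invariant complex structures [J] given by the quaternions satisfy
    [[J u, J v] = [u, v]].  Hence they are integrable ([left_endo_complex]), and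
    the connection given on left-invariant fields by
    [nabla_u v = - (ad v)^T u] is a metric connection that preserves all of
    them.  Its torsion form is minus the cyclic sum of [<[u, v], w>]; evaluated
    on four left-invariant fields spanning the [x]-space, the exterior
    derivative of that form is minus twice the number of twisted coordinates
    [y_k] ([bismut_ext_deriv], [twist_weak_HKT]).

    Completeness.  Along a path of length [l] the coordinates [x] change by at
    most [l], and the coordinates [y] by at most a multiple of [l] that depends
    only on a bound for [x].  Cauchy sequences therefore converge coordinatewise,
    and straight segments show that they converge for the distance
    ([complete_metric_two_step]).

    The metrics are not isometric because they have different growth.  Moving
    by [c] along a commutator costs only a multiple of the square root of [c],
    so a ball of large radius [m] contains about [m ^ Q] separated points and
    no more, where [Q] counts the commutator directions twice: [Q] is 9, 10 and
    11 for the three metrics.  Counting points is a purely metric notion, so an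
    isometry preserves [Q] ([isometry_homogeneous_dim]). *)

(** * Smooth maps between spaces of matrices *)

Section Calculus.
Context {R : realType} {U : normedModType R}.

Lemma CkS (W : normedModType R) k (f : U -> W) : Ck k.+1 f -> Ck k f.
Proof.
elim: k f => [|k IH] f [df dDf]; first by move=> p; exact/differentiable_continuous.
by split=> // v; apply: IH; exact: dDf.
Qed.

Lemma smooth_diff (W : normedModType R) (f : U -> W) p :
  smooth f -> differentiable f p.
Proof. by move=> /(_ 1%N)[+ _]; exact. Qed.

Lemma smooth_derivable (W : normedModType R) (f : U -> W) p v :
  smooth f -> derivable f p v.
Proof. by move=> sf; exact/diff_derivable/smooth_diff. Qed.

Lemma Ck_cst (W : normedModType R) k (w : W) : Ck k (fun _ : U => w).
Proof.
elim: k w => [|k IH] w; first exact: cst_continuous.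
split=> [p|v]; first exact: differentiable_cst.
by under eq_fun do rewrite derive_cst; exact: IH.
Qed.

Lemma CkD (W : normedModType R) k (f g : U -> W) :
  Ck k f -> Ck k g -> Ck k (fun p => f p + g p).
Proof.
elim: k f g => [|k IH] f g.
  by move=> cf cg p; apply: continuousD; [exact: cf|exact: cg].
move=> [df dDf] [dg dDg]; split=> [p|v]; first exact: differentiableD.
have -> : (fun p => 'D_v (fun p => f p + g p) p) = (fun p => 'D_v f p + 'D_v g p).
  by apply/funext => p; apply: deriveD; exact: diff_derivable.
by apply: IH; [exact: dDf|exact: dDg].
Qed.

Lemma CkM k (f g : U -> R) : Ck k f -> Ck k g -> Ck k (fun p => f p * g p).
Proof.
elim: k f g => [|k IH] f g cf cg.
  by move=> p; apply: continuousM; [exact: cf|exact: cg].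
have [cf' cg'] := (CkS cf, CkS cg); case: cf cg => df dDf [dg dDg].
split=> [p|v]; first exact: differentiableM.
have -> : (fun p => 'D_v (fun p => f p * g p) p) =
          (fun p => f p * 'D_v g p + g p * 'D_v f p).
  by apply/funext => p; apply: deriveM; exact: diff_derivable.
by apply: CkD; apply: IH => //; [exact: dDg|exact: dDf].
Qed.

Lemma Ck_sum (W : normedModType R) k (I : Type) (r : seq I) (P : pred I)
    (f : I -> U -> W) :
  (forall i, Ck k (f i)) -> Ck k (fun p => \sum_(i <- r | P i) f i p).
Proof.
move=> cf; elim: r => [|i r IH].
  by under eq_fun do rewrite big_nil; exact: Ck_cst.
under eq_fun do rewrite big_cons.
by case: (P i) => //; exact: CkD.
Qed.

Lemma CkZl (W : normedModType R) k (f : U -> R) (w : W) :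
  Ck k f -> Ck k (fun p => f p *: w).
Proof.
elim: k f => [|k IH] f.
  by move=> cf p; apply: (continuousZr_tmp (cf p)); exact: cst_continuous.
move=> [df dDf]; split=> [p|v]; first exact: differentiableZl.
have -> : (fun p => 'D_v (fun p => f p *: w) p) = (fun p => 'D_v f p *: w).
  apply/funext => p; rewrite !deriveE//; last exact: differentiableZl.
  by rewrite diffZl.
by apply: IH; exact: dDf.
Qed.

Lemma derive_coord m n (F : U -> 'M[R]_(m, n)) i j p v :
  derivable F p v -> 'D_v (fun q => F q i j) p = 'D_v F p i j.
Proof. by move=> dF; rewrite derive_mx// mxE. Qed.

Lemma Ck_coord m n k (F : U -> 'M[R]_(m, n)) i j :
  Ck k F -> Ck k (fun p => F p i j).
Proof.
elim: k F => [|k IH] F.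
  move=> cF p; apply: (@continuous_comp _ _ _ F (fun N : 'M[R]_(m, n) => N i j)).
    exact: cF.
  exact: coord_continuous.
move=> [dF dDf]; split=> [p|v].
  apply: (@differentiable_comp _ _ _ _ _ (fun N : 'M[R]_(m, n) => N i j)) => //.
  exact: differentiable_coord.
have -> : (fun p => 'D_v (fun p => F p i j) p) = (fun p => 'D_v F p i j).
  by apply/funext => p; apply: derive_coord; exact: diff_derivable.
by apply: IH; exact: dDf.
Qed.

Lemma Ck_mx m n k (F : U -> 'M[R]_(m, n)) :
  (forall i j, Ck k (fun p => F p i j)) -> Ck k F.
Proof.
move=> cF; have -> : F = fun p => \sum_i \sum_j F p i j *: delta_mx i j.
  by apply/funext => p; exact: matrix_sum_delta.
by do 2!apply: Ck_sum => ?; exact: CkZl.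
Qed.

Lemma smooth_mxP m n (F : U -> 'M[R]_(m, n)) :
  smooth F <-> forall i j, smooth (fun p => F p i j).
Proof.
by split=> [sF i j k|sF k]; [exact/Ck_coord/sF | apply: Ck_mx => i j; exact: sF].
Qed.

Lemma smooth_cst (W : normedModType R) (w : W) : smooth (fun _ : U => w).
Proof. by move=> k; exact: Ck_cst. Qed.

Lemma smoothD (W : normedModType R) (f g : U -> W) :
  smooth f -> smooth g -> smooth (fun p => f p + g p).
Proof. by move=> sf sg k; exact: CkD. Qed.

Lemma smoothM (f g : U -> R) :
  smooth f -> smooth g -> smooth (fun p => f p * g p).
Proof. by move=> sf sg k; exact: CkM. Qed.

Lemma smooth_sum (W : normedModType R) (I : Type) (r : seq I) (P : pred I)
    (f : I -> U -> W) :
  (forall i, smooth (f i)) -> smooth (fun p => \sum_(i <- r | P i) f i p).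
Proof. by move=> sf k; apply: Ck_sum => i; exact: sf. Qed.

Lemma smooth_mulmx m n q (A : U -> 'M[R]_(m, n)) (B : U -> 'M[R]_(n, q)) :
  smooth A -> smooth B -> smooth (fun p => A p *m B p).
Proof.
move=> /smooth_mxP sA /smooth_mxP sB; apply/smooth_mxP => i j.
under eq_fun do rewrite mxE.
by apply: smooth_sum => l; exact: smoothM.
Qed.

Lemma smooth_trmx m n (A : U -> 'M[R]_(m, n)) :
  smooth A -> smooth (fun p => (A p)^T).
Proof.
by move=> /smooth_mxP sA; apply/smooth_mxP => i j; under eq_fun do rewrite mxE; exact: sA.
Qed.

Lemma smoothZ m n (f : U -> R) (A : U -> 'M[R]_(m, n)) :
  smooth f -> smooth A -> smooth (fun p => f p *: A p).
Proof.
move=> sf /smooth_mxP sA; apply/smooth_mxP => i j; under eq_fun do rewrite mxE.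
exact: smoothM.
Qed.

Lemma smoothN m n (A : U -> 'M[R]_(m, n)) :
  smooth A -> smooth (fun p => - A p).
Proof.
move=> sA; under eq_fun do rewrite -scaleN1r.
by apply: smoothZ => //; exact: smooth_cst.
Qed.

Lemma smoothB m n (A B : U -> 'M[R]_(m, n)) :
  smooth A -> smooth B -> smooth (fun p => A p - B p).
Proof. by move=> sA sB; apply: smoothD => //; exact: smoothN. Qed.

Lemma derive_mulmx m n q (A : U -> 'M[R]_(m, n)) (B : U -> 'M[R]_(n, q)) p v :
  derivable A p v -> derivable B p v ->
  'D_v (fun p => A p *m B p) p = 'D_v A p *m B p + A p *m 'D_v B p.
Proof.
move=> dA dB; have [dA' dB'] := ((derivable_mxP _ _ _).1 dA, (derivable_mxP _ _ _).1 dB).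
have dAB i j : is_derive p v (fun p => (A p *m B p) i j)
    ((\sum_l (A p i l *: 'D_v B p l j + B p l j *: 'D_v A p i l))).
  have -> : (fun p => (A p *m B p) i j) = \sum_l (fun p => A p i l * B p l j).
    by apply/funext => x; rewrite mxE fct_sumE.
  apply: is_derive_sum => l; rewrite -!derive_coord//.
  by apply: is_deriveM; exact: derivableP.
have dM : derivable (fun p => A p *m B p) p v.
  by apply/derivable_mxP => i j; apply: (@ex_derive _ _ _ _ _ _ _ (dAB i j)).
apply/matrixP => i j; rewrite -derive_coord// derive_val !mxE -big_split.
by apply: eq_bigr => l _; rewrite addrC /= /GRing.scale /= (mulrC (B p l j)).
Qed.

End Calculus.

Lemma smooth_id {R : realType} {U : normedModType R} : smooth (@id U).
Proof.
case=> [|k]; first by move=> p.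
split=> [p|v]; first exact: ex_diff.
by under eq_fun do rewrite derive_id; exact: Ck_cst.
Qed.

Lemma derive_comp {R : realType} {U V W : normedModType R}
    (phi : V -> W) (gam : U -> V) p v :
  differentiable phi (gam p) -> differentiable gam p ->
  'D_v (phi \o gam) p = 'd phi (gam p) ('D_v gam p).
Proof.
move=> dphi dgam; rewrite !deriveE//; last exact: differentiable_comp.
by rewrite diff_comp.
Qed.

(** The directional derivative of a composition is a linear combination of the
    compositions with the partial derivatives; the induction on the order of
    differentiability therefore runs over all outer maps at once. *)
Lemma smooth_comp_scalar {R : realType} {U : normedModType R} {m : nat}
    (phi : 'cV[R]_m -> R) (gam : U -> 'cV[R]_m) :
  smooth phi -> smooth gam -> smooth (phi \o gam).
Proof.
move=> sphi sgam k; elim: k phi sphi => [|k IH] phi sphi.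
  by move=> p; apply: continuous_comp; [exact: (sgam 0%N) | exact: (sphi 0%N)].
split=> [p|v]; first by apply: differentiable_comp; exact: smooth_diff.
have -> : (fun p => 'D_v (phi \o gam) p) = fun p =>
    \sum_i 'D_v gam p i 0 * ('D_(delta_mx i 0) phi \o gam) p.
  apply/funext => p; have dphi := smooth_diff (gam p) sphi.
  have dgam := smooth_diff p sgam.
  rewrite derive_comp//; set w := 'D_v gam p.
  rewrite [in LHS](matrix_sum_delta w) linear_sum; apply: eq_bigr => i _.
  by rewrite big_ord1 linearZ /= deriveE.
apply: Ck_sum => i; apply: CkM.
  by apply: Ck_coord; exact: (sgam k.+1).2.
by apply: IH => l; exact: (sphi l.+1).2.
Qed.

Lemma smooth_comp {R : realType} {U : normedModType R} {m n q : nat}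
    (phi : 'cV[R]_m -> 'M[R]_(n, q)) (gam : U -> 'cV[R]_m) :
  smooth phi -> smooth gam -> smooth (phi \o gam).
Proof.
move=> /smooth_mxP sphi sgam; apply/smooth_mxP => i j.
exact: (smooth_comp_scalar (sphi i j) sgam).
Qed.

Section LinearOfColumns.
Context {R : realType} {m : nat} {W : normedModType R}.
Variable f : {linear 'cV[R]_m -> W}.

Lemma smooth_linear : smooth f.
Proof.
move=> k; have -> : (f : _ -> _) = fun v => \sum_i v i 0 *: f (delta_mx i 0).
  apply/funext => v; rewrite {1}(matrix_sum_delta v) linear_sum.
  by apply: eq_bigr => i _; rewrite big_ord1 linearZ.
by apply: Ck_sum => i; apply: CkZl; apply: Ck_coord; exact: smooth_id.
Qed.

Lemma diff_linear p v : 'd f p v = f v.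
Proof. by rewrite diff_lin//; exact: smooth_linear 0%N. Qed.

Lemma derive_linear p v : 'D_v f p = f v.
Proof. by rewrite deriveE ?diff_linear//; exact/smooth_diff/smooth_linear. Qed.

End LinearOfColumns.

Section DirectionalDerivative.
Context {R : realType} {U : normedModType R}.

Lemma derive_dirD (W : normedModType R) (f : U -> W) p u v :
  smooth f -> 'D_(u + v) f p = 'D_u f p + 'D_v f p.
Proof. by move=> /(@smooth_diff _ _ _ _ p) df; rewrite !deriveE// linearD. Qed.

Lemma derive_dirZ (W : normedModType R) (f : U -> W) p c v :
  smooth f -> 'D_(c *: v) f p = c *: 'D_v f p.
Proof. by move=> /(@smooth_diff _ _ _ _ p) df; rewrite !deriveE// linearZ. Qed.

Lemma derive_trmx m n (A : U -> 'M[R]_(m, n)) p v :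
  smooth A -> 'D_v (fun q => (A q)^T) p = ('D_v A p)^T.
Proof.
move=> sA; apply/matrixP => i j; rewrite mxE -!derive_coord.
- by congr ('D_v _ p); apply/funext => q; rewrite mxE.
- exact: smooth_derivable.
- exact/smooth_derivable/smooth_trmx.
Qed.

End DirectionalDerivative.

Lemma smooth_derive_along {R : realType} {m n q : nat}
    (f : 'cV[R]_m -> 'M[R]_(n, q)) (X : 'cV[R]_m -> 'cV[R]_m) :
  smooth f -> smooth X -> smooth (fun p => 'D_(X p) f p).
Proof.
move=> sf sX; have -> : (fun p => 'D_(X p) f p) =
    fun p => \sum_i X p i 0 *: 'D_(delta_mx i 0) f p.
  apply/funext => p; rewrite deriveE; last exact: smooth_diff.
  rewrite {1}(matrix_sum_delta (X p)) linear_sum; apply: eq_bigr => i _.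
  by rewrite big_ord1 linearZ /= deriveE//; exact: smooth_diff.
apply: smooth_sum => i; apply: smoothZ; first exact: (smooth_mxP _).1 sX i 0.
by move=> k; exact: (sf k.+1).2.
Qed.

(** * Two-step nilpotent groups with a left-invariant metric *)

Record two_step (R : realType) (n : nat) := TwoStep {
  ad :> {linear 'cV[R]_n.+1 -> 'M[R]_n.+1};
  ad_self : forall u, ad u *m u = 0;
  ad_bracket : forall u v, ad (ad u *m v) = 0 }.

Section TwoStep.
Context {R : realType} {n : nat} (L : two_step R n).
Local Notation V := 'cV[R]_n.+1.
Implicit Types (p q u v w : V) (X Y Z : V -> V) (I J : 'M[R]_n.+1).

Lemma ad_anti u v : L u *m v = - (L v *m u).
Proof.
apply/eqP; rewrite -addr_eq0; have := ad_self L (u + v).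
by rewrite [L (u + v)]linearD /= mulmxDl !mulmxDr !ad_self addr0 add0r => ->.
Qed.

Lemma ad_mul u v : L u *m L v = 0.
Proof.
apply/matrixP => i j; have := ad_bracket L v (delta_mx j 0).
move=> /(congr1 (mulmx^~ u)); rewrite mul0mx ad_anti => /eqP; rewrite oppr_eq0.
move=> /eqP; rewrite mulmxA => /matrixP/(_ i 0).
by rewrite -colE mxE !mxE.
Qed.

(** The columns of [frame p] are the left-invariant vector fields that agree with
    the coordinate fields at the origin, and [coframe p] is the dual coframe:
    [frame p] is the differential at the origin of the left translation by [p]. *)
Definition coframe p : 'M[R]_n.+1 := 1%:M - 2^-1 *: L p.
Definition frame p : 'M[R]_n.+1 := 1%:M + 2^-1 *: L p.
Definition metric p : 'M[R]_n.+1 := (coframe p)^T *m coframe p.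
(** The components of a vector field in the left-invariant frame. *)
Definition body X : V -> V := fun p => coframe p *m X p.
Definition left_endo (J : 'M[R]_n.+1) : V -> 'M[R]_n.+1 :=
  fun p => frame p *m J *m coframe p.

Lemma coframeK p : coframe p *m frame p = 1%:M.
Proof.
rewrite /coframe /frame mulmxDr mulmx1 mulmxBl mul1mx -scalemxAl -scalemxAr.
by rewrite ad_mul !scaler0 subr0 subrK.
Qed.

Lemma frameK p : frame p *m coframe p = 1%:M.
Proof.
rewrite /coframe /frame mulmxBr mulmx1 mulmxDl mul1mx -scalemxAl -scalemxAr.
by rewrite ad_mul !scaler0 addr0 addrK.
Qed.

Lemma frame_body X p : frame p *m body X p = X p.
Proof. by rewrite mulmxA frameK mul1mx. Qed.

Lemma body_frame (x : V -> V) p : body (fun q => frame q *m x q) p = x p.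
Proof. by rewrite /body mulmxA coframeK mul1mx. Qed.

Lemma frame_bracket p u v : frame p *m (L u *m v) = L u *m v.
Proof. by rewrite mulmxDl mul1mx -scalemxAl !mulmxA ad_mul mul0mx scaler0 addr0. Qed.

Lemma ad_frame p u : L (frame p *m u) = L u.
Proof.
by rewrite mulmxDl mul1mx -scalemxAl linearD linearZ /= ad_bracket scaler0 addr0.
Qed.

Lemma smooth_ad {U : normedModType R} (f : U -> V) :
  smooth f -> smooth (fun t => L (f t)).
Proof. by move=> sf; exact: smooth_comp (smooth_linear L) sf. Qed.

Lemma smooth_coframe {U : normedModType R} (f : U -> V) :
  smooth f -> smooth (fun t => coframe (f t)).
Proof.
move=> sf; apply: smoothB; first exact: smooth_cst.
by apply: smoothZ; [exact: smooth_cst | exact: smooth_ad].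
Qed.

Lemma smooth_frame {U : normedModType R} (f : U -> V) :
  smooth f -> smooth (fun t => frame (f t)).
Proof.
move=> sf; apply: smoothD; first exact: smooth_cst.
by apply: smoothZ; [exact: smooth_cst | exact: smooth_ad].
Qed.

Lemma smooth_metric {U : normedModType R} (f : U -> V) :
  smooth f -> smooth (fun t => metric (f t)).
Proof.
by move=> sf; apply: smooth_mulmx; [apply: smooth_trmx|]; exact: smooth_coframe.
Qed.

Lemma smooth_body X : smooth X -> smooth (body X).
Proof. by move=> sX; apply: smooth_mulmx => //; apply: smooth_coframe; exact: smooth_id. Qed.

Lemma smooth_left X : smooth X -> smooth (fun p => frame p *m X p).
Proof. by move=> sX; apply: smooth_mulmx => //; apply: smooth_frame; exact: smooth_id. Qed.

Lemma pairing_metric p v w :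
  pairing (metric p) v w = ((coframe p *m v)^T *m (coframe p *m w)) 0 0.
Proof. by rewrite /pairing /metric trmx_mul !mulmxA. Qed.

Lemma innerE X Y p : inner metric X Y p = ((body X p)^T *m body Y p) 0 0.
Proof. exact: pairing_metric. Qed.

Lemma norm2E v : (v^T *m v) 0 0 = \sum_i v i 0 ^+ 2.
Proof. by rewrite mxE; apply: eq_bigr => i _; rewrite mxE expr2. Qed.

Lemma riemannian_metric : riemannian metric.
Proof.
split=> [|p|p v v0]; first exact/smooth_metric/smooth_id.
  by rewrite /metric trmx_mul trmxK.
have : coframe p *m v != 0.
  apply: contra v0 => /eqP/(congr1 (mulmx (frame p))).
  by rewrite mulmxA frameK mul1mx mulmx0 => ->.
rewrite pairing_metric norm2E; apply: contraNT; rewrite -leNgt => s0.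
have : \sum_i (coframe p *m v) i 0 ^+ 2 == 0.
  by rewrite eq_le s0; apply: sumr_ge0 => i _; exact: sqr_ge0.
rewrite psumr_eq0 => [/allP z|i _]; last exact: sqr_ge0.
apply/eqP/colP => i; rewrite [RHS]mxE; apply/eqP; rewrite -sqrf_eq0.
exact: z (mem_index_enum i).
Qed.

Lemma derive_frame_mul (x : V -> V) p v : smooth x ->
  'D_v (fun q => frame q *m x q) p = 2^-1 *: (L v *m x p) + frame p *m 'D_v x p.
Proof.
move=> sx; have sF : smooth frame by exact/smooth_frame/smooth_id.
rewrite derive_mulmx; [|exact: smooth_derivable..].
congr (_ + _); rewrite scalemxAl; congr (_ *m _).
have dL : is_derive p v (L : V -> 'M[R]_n.+1) (L v).
  have sL := smooth_linear L; rewrite -(derive_linear L p v).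
  by apply: derivableP; exact: smooth_derivable.
have dF := is_deriveD (is_derive_cst (1%:M : 'M[R]_n.+1) p v) (is_deriveZ (2^-1) dL).
by rewrite (_ : frame = cst 1%:M + 2^-1 *: (L : V -> 'M[R]_n.+1))// derive_val add0r.
Qed.

Lemma derive_field X p v : smooth X ->
  'D_v X p = 2^-1 *: (L v *m body X p) + frame p *m 'D_v (body X) p.
Proof.
by move=> sX; rewrite -derive_frame_mul ?(funext (frame_body X))//; exact: smooth_body.
Qed.

(** The derivatives of the two frames contribute [[x, y] / 2] each. *)
Lemma bracketE X Y p : smooth X -> smooth Y ->
  bracket X Y p = frame p *m
    ('D_(X p) (body Y) p - 'D_(Y p) (body X) p + L (body X p) *m body Y p).
Proof.
move=> sX sY; rewrite /bracket.
rewrite (derive_field _ _ sX) (derive_field _ _ sY).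
have adF Z : L (Z p) = L (body Z p) by rewrite -[RHS](ad_frame p) frame_body.
rewrite (adF X) (adF Y) (ad_anti (body Y p)) !mulmxDr mulmxN frame_bracket.
rewrite scalerN opprD opprK addrACA -scalerDl addrC; congr (_ + _).
have h : 2^-1 + 2^-1 = 1 :> R by lra.
by rewrite h scale1r.
Qed.

Lemma body_bracket X Y p : smooth X -> smooth Y ->
  body (bracket X Y) p =
  'D_(X p) (body Y) p - 'D_(Y p) (body X) p + L (body X p) *m body Y p.
Proof. by move=> sX sY; rewrite /body bracketE// mulmxA coframeK mul1mx. Qed.

Section LeftInvariantComplex.
Variable J : 'M[R]_n.+1.
Hypotheses (JJ : J *m J = - 1%:M)
  (J_abelian : forall u v, L (J *m u) *m (J *m v) = L u *m v).

Lemma body_app X p : body (app (left_endo J) X) p = J *m body X p.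
Proof. by rewrite /body /app /left_endo !mulmxA coframeK mul1mx. Qed.

Lemma smooth_left_endo : smooth (left_endo J).
Proof.
apply: smooth_mulmx; last exact/smooth_coframe/smooth_id.
by apply: smooth_mulmx; [exact/smooth_frame/smooth_id | exact: smooth_cst].
Qed.

Lemma smooth_app X : smooth X -> smooth (app (left_endo J) X).
Proof. by move=> sX; apply: smooth_mulmx => //; exact: smooth_left_endo. Qed.

Lemma derive_body_app X p v : smooth X ->
  'D_v (body (app (left_endo J) X)) p = J *m 'D_v (body X) p.
Proof.
move=> sX; rewrite (funext (body_app X)) derive_mulmx.
- by rewrite derive_cst mul0mx add0r.
- exact: derivable_cst.
- exact/smooth_derivable/smooth_body.
Qed.

(** Since [[J x, J y] = [x, y]] and [[J x, y] = - [x, J y]], the algebraic part of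
    the Nijenhuis tensor vanishes; the derivatives cancel because [J] is constant
    in the left-invariant frame. *)
Lemma left_endo_complex : complex_structure (left_endo J).
Proof.
split=> [|p|X Y sX sY p]; first exact: smooth_left_endo.
  have -> : left_endo J p *m left_endo J p =
      frame p *m (J *m (coframe p *m frame p) *m J) *m coframe p.
    by rewrite /left_endo !mulmxA.
  by rewrite coframeK mulmx1 JJ mulmxN mulmx1 mulNmx frameK.
have [sJX sJY] := (smooth_app sX, smooth_app sY).
have appE Z : app (left_endo J) Z p = frame p *m (J *m body Z p).
  by rewrite -body_app frame_body.
rewrite /nijenhuis 2!(appE (bracket _ _)) !body_bracket// !bracketE//.
rewrite !derive_body_app// !body_app.
set a := 'D__ (body Y) p; set b := 'D__ (body X) p.
set c : V := 'D_(Y p) (body X) p; set d : V := 'D_(X p) (body Y) p.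
set x := body X p; set y := body Y p.
have anti : L (J *m x) *m y = - (L x *m (J *m y)).
  by rewrite -[in RHS]J_abelian [J *m (J *m y)]mulmxA JJ mulNmx mul1mx mulmxN opprK.
rewrite J_abelian anti -!mulmxBr !mulmxDr !mulmxN !(mulmxA J J) JJ !mulNmx !mul1mx.
move: (J *m a) (J *m b) (J *m (L x *m (J *m y))) (L x *m y) => e1 e2 e3 e4.
rewrite -!(mulmxBr, mulmxDr) [X in frame p *m X](_ : _ = 0) ?mulmx0//.
apply/colP => i; rewrite !mxE; ring.
Qed.

End LeftInvariantComplex.
End TwoStep.

(** * Left-invariant HKT structures *)

Lemma mulmx_ext (R : pzSemiRingType) m n (A B : 'M[R]_(m, n)) :
  (forall u : 'cV_n, A *m u = B *m u) -> A = B.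
Proof.
by move=> AB; apply/matrixP => i j; have /colP/(_ i) := AB (delta_mx j 0); rewrite -!colE !mxE.
Qed.

Section InnerProduct.
Context {R : realType} {m : nat}.
Implicit Types (u v w : 'cV[R]_m) (A : 'M[R]_m).

Definition ip u v : R := (u^T *m v) 0 0.

Lemma ipC u v : ip u v = ip v u.
Proof. by rewrite /ip -[in LHS](trmxK v) -trmx_mul mxE. Qed.

Lemma ipDl u v w : ip (u + v) w = ip u w + ip v w.
Proof. by rewrite /ip linearD mulmxDl mxE. Qed.

Lemma ipDr u v w : ip w (u + v) = ip w u + ip w v.
Proof. by rewrite /ip mulmxDr mxE. Qed.

Lemma ipZl c u w : ip (c *: u) w = c * ip u w.
Proof. by rewrite /ip linearZ -scalemxAl mxE. Qed.

Lemma ipZr c u w : ip u (c *: w) = c * ip u w.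
Proof. by rewrite /ip -scalemxAr mxE. Qed.

Lemma ipNl u w : ip (- u) w = - ip u w.
Proof. by rewrite -scaleN1r ipZl mulN1r. Qed.

Lemma ipNr u w : ip u (- w) = - ip u w.
Proof. by rewrite -scaleN1r ipZr mulN1r. Qed.

Lemma ip0l u : ip 0 u = 0.
Proof. by rewrite /ip trmx0 mul0mx mxE. Qed.

Lemma ip_trmx A u v : ip u (A^T *m v) = ip (A *m u) v.
Proof. by rewrite /ip trmx_mul mulmxA. Qed.

Lemma ip_delta u i : ip u (delta_mx i 0) = u i 0.
Proof. by rewrite /ip -colE !mxE. Qed.

End InnerProduct.

Section HKT.
Context {R : realType} {n : nat} (L : two_step R n).
Local Notation V := 'cV[R]_n.+1.
Implicit Types (u v w x y z : V) (X Y Z : V -> V).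

(** The last condition says that [J] defines an abelian complex structure: its
    [(1, 0)]-vectors form an abelian algebra. *)
Definition left_hermitian (J : 'M[R]_n.+1) :=
  [/\ J *m J = - 1%:M, J^T *m J = 1%:M
    & forall u v, L (J *m u) *m (J *m v) = L u *m v].

(** On left-invariant fields the Koszul-type formula for the connection with skew
    torsion reduces, for an abelian complex structure, to
    [<nabla_x y, z> = - <x, [y, z]>]; it does not involve [J], which is why a single
    connection serves all the complex structures. *)
Definition bismut X Y : V -> V := fun p =>
  frame L p *m ('D_(X p) (body L Y) p - (L (body L Y p))^T *m body L X p).

Lemma body_bismut X Y p :
  body L (bismut X Y) p = 'D_(X p) (body L Y) p - (L (body L Y p))^T *m body L X p.
Proof. by rewrite /body /bismut mulmxA coframeK mul1mx. Qed.

Lemma bodyD X Y p : body L (X \+ Y) p = body L X p + body L Y p.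
Proof. by rewrite /body mulmxDr. Qed.

Lemma bodyZ (f : V -> R) X p : body L (fun q => f q *: X q) p = f p *: body L X p.
Proof. by rewrite /body -scalemxAr. Qed.

Lemma derive_bodyZ (f : V -> R) Y p v : smooth f -> smooth Y ->
  'D_v (body L (fun q => f q *: Y q)) p = 'D_v f p *: body L Y p + f p *: 'D_v (body L Y) p.
Proof.
move=> sf sY; have sbY := smooth_body L sY.
rewrite (funext (bodyZ f Y)); move: (body L Y) sbY => y sy.
apply/colP => i; rewrite !mxE -!derive_coord; last 2 first.
- exact: smooth_derivable.
- exact/smooth_derivable/smoothZ.
have -> : (fun q => (f q *: y q) i 0) = f * (fun q => y q i 0).
  by apply/funext => q; rewrite mxE.
have syi : smooth (fun q => y q i 0) by exact: (smooth_mxP _).1 sy i 0.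
rewrite deriveM; [|exact: smooth_derivable..].
by rewrite addrC /GRing.scale /= (mulrC (y p i 0)).
Qed.

Lemma bismut_connection : connection bismut.
Proof.
split.
- move=> X Y sX sY; have [sbX sbY] := (smooth_body L sX, smooth_body L sY).
  apply: smooth_left; apply: smoothB; first exact: smooth_derive_along.
  by apply: smooth_mulmx => //; apply: smooth_trmx; exact: smooth_ad.
- move=> X Y Z sX sY sZ p; have sbZ := smooth_body L sZ.
  rewrite -mulmxDr; congr (_ *m _); rewrite bodyD mulmxDr derive_dirD//.
  by rewrite opprD addrACA.
- move=> f X Y sf sX sY p; have sbY := smooth_body L sY.
  rewrite /bismut bodyZ derive_dirZ//.
  by rewrite -scalemxAr -scalerBr -scalemxAr.
- move=> X Y Z sX sY sZ p; have [sbY sbZ] := (smooth_body L sY, smooth_body L sZ).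
  rewrite -mulmxDr; congr (_ *m _); rewrite bodyD (funext (bodyD Y Z)).
  rewrite deriveD; [|exact: smooth_derivable..].
  by rewrite [L (_ + _)]linearD linearD /= mulmxDl opprD addrACA.
- move=> f X Y sf sX sY p; have sbY := smooth_body L sY.
  rewrite -{1}(frame_body L Y p) (scalemxAr (lie_deriv X f p)) (scalemxAr (f p)).
  rewrite -mulmxDr; congr (_ *m _).
  rewrite derive_bodyZ// bodyZ [L (_ *: _)]linearZ linearZ /= -scalemxAl.
  by rewrite scalerBr addrA.
Qed.

Lemma inner_ip X Y p : inner (metric L) X Y p = ip (body L X p) (body L Y p).
Proof. exact: innerE. Qed.

(** The algebraic part of the connection is skew because the bracket is. *)
Lemma bismut_metric : metric_connection bismut (metric L).
Proof.
move=> X Y Z sX sY sZ p; have [sbY sbZ] := (smooth_body L sY, smooth_body L sZ).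
rewrite !inner_ip !body_bismut /lie_deriv (funext (inner_ip Y Z)).
rewrite derive_coord; last first.
  by apply/smooth_derivable/smooth_mulmx => //; exact: smooth_trmx.
rewrite derive_mulmx; [|apply: smooth_derivable..]; last 2 first.
- exact: smooth_trmx.
- by [].
rewrite derive_trmx// mxE -!/(ip _ _) !(ipDl, ipDr, ipNl, ipNr).
rewrite ip_trmx (ipC (_^T *m _)) ip_trmx (ad_anti L (body L Z p)) ipNl.
by ring.
Qed.

(** Abelianness and [J^T = - J] give [ad (J y) = ad y *m J^T]. *)
Lemma bismut_parallel J : left_hermitian J -> parallel_endo bismut (left_endo L J).
Proof.
move=> [JJ JtJ ab] X Y sX sY p.
have JT : J^T = - J by rewrite -[LHS]mulmx1 -[1%:M]opprK -JJ mulmxN mulmxA JtJ mul1mx.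
rewrite -[RHS](frame_body L) body_app -[LHS](frame_body L) !body_bismut; congr (_ *m _).
rewrite derive_body_app// body_app mulmxBr; congr (_ - _).
move: (body L X p) (body L Y p) => x y.
rewrite (mulmxA J); congr (_ *m x); apply: trmx_inj; rewrite trmx_mul !trmxK JT.
apply: mulmx_ext => u.
by rewrite mulmxN mulNmx -mulmxA -mulmxN -[in RHS]ab mulmxN (mulmxA J) JJ mulNmx mul1mx opprK.
Qed.

Definition torsion_trilinear x y z : R :=
  - (ip (L x *m y) z + ip (L y *m z) x + ip (L z *m x) y).

Lemma torsion_formE X Y Z p : smooth Y -> smooth Z ->
  torsion_form bismut (metric L) X Y Z p =
  torsion_trilinear (body L X p) (body L Y p) (body L Z p).
Proof.
move=> sY sZ; rewrite /torsion_form inner_ip /torsion.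
have -> : body L (fun p => bismut Y Z p - bismut Z Y p - bracket Y Z p) p =
   body L (bismut Y Z) p - body L (bismut Z Y) p - body L (bracket Y Z) p.
  by rewrite /body !mulmxBr.
rewrite !body_bismut body_bracket//; set a : V := 'D__ _ _; set b : V := 'D__ _ _.
move: (body L X p) (body L Y p) (body L Z p) => x y z.
rewrite !(ipDr, ipNr) !ip_trmx /torsion_trilinear (ad_anti L y x) ipNl (ipC x (L y *m z)).
ring.
Qed.

Lemma bismut_three_form : three_form (torsion_form bismut (metric L)).
Proof.
split.
- move=> X Y Z sX sY sZ.
  have -> : torsion_form bismut (metric L) X Y Z = fun p =>
      torsion_trilinear (body L X p) (body L Y p) (body L Z p).
    by apply/funext => p; exact: torsion_formE.
  have sip (f g : V -> V) : smooth f -> smooth g -> smooth (fun p => ip (f p) (g p)).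
    move=> sf sg; apply: (fun s => (smooth_mxP _).1 s 0 0).
    by apply: smooth_mulmx => //; exact: smooth_trmx.
  have sbr (f g : V -> V) : smooth f -> smooth g -> smooth (fun p => L (f p) *m g p).
    by move=> sf sg; apply: smooth_mulmx => //; exact: smooth_ad.
  rewrite /torsion_trilinear; under eq_fun do rewrite -mulN1r.
  apply: smoothM; first exact: smooth_cst.
  have [sbX sbY sbZ] := And3 (smooth_body L sX) (smooth_body L sY) (smooth_body L sZ).
  by do !apply: smoothD; apply: sip => //; exact: sbr.
- move=> X X' Y Z sX sX' sY sZ p; rewrite !torsion_formE// bodyD /torsion_trilinear.
  by rewrite [L (_ + _)]linearD /= mulmxDl mulmxDr !(ipDl, ipDr); ring.
- move=> f X Y Z sf sX sY sZ p; rewrite !torsion_formE// bodyZ /torsion_trilinear.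
  by rewrite [L (_ *: _)]linearZ /= -scalemxAl -scalemxAr !(ipZl, ipZr); ring.
- move=> X Y Z sX sY sZ p; rewrite !torsion_formE// /torsion_trilinear.
  set x := body L X p; set y := body L Y p; set z := body L Z p.
  by rewrite (ad_anti L y x) (ad_anti L x z) (ad_anti L z y) !ipNl; ring.
- move=> X Y Z sX sY sZ p; rewrite !torsion_formE// /torsion_trilinear.
  set x := body L X p; set y := body L Y p; set z := body L Z p.
  by rewrite (ad_anti L x z) (ad_anti L z y) (ad_anti L y x) !ipNl; ring.
Qed.

(** Brackets of left-invariant fields are central, so that only the pairings of
    brackets of complementary pairs survive in the exterior derivative. *)
Lemma bismut_ext_deriv a b c d p :
  let left u := fun q => frame L q *m u in
  ext_deriv (torsion_form bismut (metric L)) (left a) (left b) (left c) (left d) p =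
  2 * (ip (L a *m b) (L c *m d) - ip (L a *m c) (L b *m d)
       + ip (L a *m d) (L b *m c)).
Proof.
move=> left; have sl u : smooth (left u) by apply: smooth_left; exact: smooth_cst.
have bl u : body L (left u) = cst u by apply/funext => q; rewrite body_frame.
have lt u v w X : lie_deriv X (torsion_form bismut (metric L) (left u) (left v) (left w)) p = 0.
  have -> : torsion_form bismut (metric L) (left u) (left v) (left w) =
      cst (torsion_trilinear u v w).
    by apply/funext => q; rewrite torsion_formE// !bl.
  exact: derive_cst.
have tb u v w z : torsion_form bismut (metric L) (bracket (left u) (left v)) (left w) (left z) p
    = - ip (L u *m v) (L w *m z).
  rewrite torsion_formE// body_bracket// !bl !derive_cst subrr add0r /torsion_trilinear.
  rewrite ad_bracket mul0mx (ad_anti L z) ad_bracket mul0mx oppr0.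
  by rewrite !ip0l add0r addr0 ipC.
rewrite /ext_deriv; move: lt tb; clear sl bl; clearbody left.
move: (torsion_form bismut (metric L)) (@bracket R n) => T br lt tb.
rewrite (lt b c d) (lt a c d) (lt a b d) (lt a b c).
rewrite (tb a b c d) (tb a c b d) (tb a d b c) (tb b c a d) (tb b d a c) (tb c d a b).
rewrite (ipC (L c *m d)) (ipC (L b *m d)) (ipC (L b *m c)); ring.
Qed.

Lemma left_hermitianM (I J : 'M[R]_n.+1) :
  left_hermitian I -> left_hermitian J -> I *m J = - (J *m I) ->
  left_hermitian (I *m J).
Proof.
move=> [II ItI aI] [JJ JtJ aJ] IJ; split=> [||u v].
- by rewrite {1}IJ mulNmx mulmxA -(mulmxA J I I) II mulmxN mulmx1 mulNmx JJ opprK.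
- by rewrite trmx_mul -mulmxA (mulmxA _ I J) ItI mul1mx.
- by rewrite -!mulmxA aI aJ.
Qed.

Lemma left_endoM I J p : left_endo L I p *m left_endo L J p = left_endo L (I *m J) p.
Proof.
by rewrite /left_endo !mulmxA -(mulmxA _ (coframe L p)) coframeK mulmx1.
Qed.

Lemma left_hermitian_metric J : left_hermitian J -> Defs.hermitian (left_endo L J) (metric L).
Proof.
move=> [_ JtJ _] p v w; rewrite !pairing_metric.
have bJ u : coframe L p *m (left_endo L J p *m u) = J *m (coframe L p *m u).
  by rewrite /left_endo !mulmxA coframeK mul1mx.
by rewrite !bJ trmx_mul -mulmxA (mulmxA (trmx J) J) JtJ mul1mx.
Qed.

Lemma left_weak_HKT (I J : 'M[R]_n.+1) a b c d :
  left_hermitian I -> left_hermitian J -> I *m J = - (J *m I) ->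
  ip (L a *m b) (L c *m d) - ip (L a *m c) (L b *m d)
    + ip (L a *m d) (L b *m c) != 0 ->
  exists J1 J2 J3, weak_HKT J1 J2 J3 (metric L).
Proof.
move=> hI hJ IJ dc; have hK := left_hermitianM hI hJ IJ.
exists (left_endo L I), (left_endo L J), (left_endo L (I *m J)).
have [[II _ aI] [JJ _ aJ] [KK _ aK]] := And3 hI hJ hK.
split.
  split; last by split; exact: left_hermitian_metric.
    split; [exact: left_endo_complex..| |] => p; rewrite !left_endoM//.
    by rewrite IJ /left_endo mulmxN mulNmx.
  exact: riemannian_metric.
exists bismut; split.
  split; [exact: bismut_connection | exact: bismut_metric | |
          exact: bismut_three_form].
  by split; exact: bismut_parallel.
have sl u : smooth (fun q => frame L q *m u) by apply: smooth_left; exact: smooth_cst.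
exists (fun q => frame L q *m a), (fun q => frame L q *m b).
exists (fun q => frame L q *m c), (fun q => frame L q *m d).
split=> //; exists 0; rewrite bismut_ext_deriv mulf_neq0//.
Qed.

End HKT.

(** * Left translations *)

Definition nil_group (R : realType) n (L : two_step R n) : Type := 'cV[R]_n.+1.

Section NilGroup.
Context {R : realType} {n : nat} (L : two_step R n).
Local Notation V := 'cV[R]_n.+1.
Implicit Types a b c p q : V.

Definition translate a p : V := a + frame L a *m p.

Lemma translateE a p : translate a p = a + p + 2^-1 *: (L a *m p).
Proof. by rewrite /translate /frame mulmxDl mul1mx -scalemxAl addrA. Qed.

Lemma ad_translate a b : L (translate a b) = L a + L b.
Proof. by rewrite linearD /= ad_frame. Qed.

Lemma frame_translate a b : frame L (translate a b) = frame L a *m frame L b.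
Proof.
rewrite /frame ad_translate mulmxDr mulmx1 mulmxDl mul1mx -scalemxAl -scalemxAr.
by rewrite ad_mul !scaler0 addr0 scalerDr addrA.
Qed.

Lemma translateA : associative translate.
Proof.
move=> a b c; rewrite [in RHS]/translate frame_translate -mulmxA.
by rewrite /translate mulmxDr addrA.
Qed.

Lemma translate0p : left_id 0 translate.
Proof. by move=> p; rewrite translateE linear0 mul0mx scaler0 addr0 add0r. Qed.

Lemma translatep0 : right_id 0 translate.
Proof. by move=> p; rewrite /translate mulmx0 addr0. Qed.

Lemma translateNp : left_inverse 0 -%R translate.
Proof.
by move=> p; rewrite translateE addNr linearN /= mulNmx ad_self oppr0 scaler0 addr0.
Qed.

Lemma translatepN : right_inverse 0 -%R translate.
Proof. by move=> p; rewrite translateE subrr mulmxN ad_self oppr0 scaler0 addr0. Qed.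

HB.instance Definition _ := Choice.on (nil_group L).
HB.instance Definition _ := isGroup.Build (nil_group L)
  translateA translate0p translatep0 translateNp translatepN.

Lemma nil_groupM (a b : nil_group L) : (a * b)%g = translate a b.
Proof. by []. Qed.

(** [ad] is a homomorphism from the group to an additive group, so it kills
    commutators, and elements that it kills are central. *)
Lemma nilpotent_nil_group : nilpotent_group (nil_group L).
Proof.
have adV (a : nil_group L) : L (a^-1)%g = - L a by exact: linearN.
have adM (a b : nil_group L) : L (a * b)%g = L a + L b by exact: ad_translate.
have central (z : nil_group L) : lower_central 1 z -> L z = 0.
  elim=> [|_ [x [y [_ ->]]]|x y _ x0 _ y0|x _ x0]; first exact: linear0.
  - by rewrite /commg /conjg !(adM, adV); apply/matrixP => i j; rewrite !mxE; ring.
  - by rewrite adM x0 y0 addr0.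
  - by rewrite adV x0 oppr0.
exists 2%N => z; elim=> [//|_ [x [y [/central x0 ->]]]|x y _ -> _ ->|x _ ->].
- apply/eqP/commgP; rewrite /commute !nil_groupM !translateE (ad_anti L y) x0.
  by rewrite mul0mx oppr0 addrAC addrC addrA addrAC.
- exact: mulg1.
- exact: invg1.
Qed.

Lemma smooth_translate a : smooth (translate a).
Proof.
apply: smoothD; first exact: smooth_cst.
by apply: smooth_mulmx; [exact: smooth_cst | exact: smooth_id].
Qed.

Lemma diff_translate a p v : 'd (translate a) p v = frame L a *m v.
Proof.
rewrite -deriveE; last exact/smooth_diff/smooth_translate.
rewrite deriveD; [|exact: derivable_cst|]; last first.
  by apply/smooth_derivable/smooth_mulmx; [exact: smooth_cst | exact: smooth_id].
rewrite derive_cst add0r derive_mulmx; [|exact: derivable_cst|exact: derivable_id].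
by rewrite derive_cst mul0mx add0r derive_id.
Qed.

Lemma coframe_translate a p : coframe L (translate a p) *m frame L a = coframe L p.
Proof.
rewrite -[LHS]mulmx1 -(frameK L p) mulmxA -mulmxA -(mulmxA _ (frame L a)).
rewrite (mulmxA (frame L a)) -frame_translate.
by rewrite !mulmxA coframeK mul1mx.
Qed.

Lemma translate_isometry a : riem_isometry (metric L) (metric L) (translate a).
Proof.
split; first exact: smooth_translate.
- exists (translate (- a)); split; first exact: smooth_translate.
  + by move=> p; rewrite translateA translateNp translate0p.
  + by move=> p; rewrite translateA translatepN translate0p.
- move=> p v w; rewrite !pairing_metric !diff_translate.
  by rewrite !(mulmxA (coframe L _)) coframe_translate.
Qed.

Lemma transitive_metric : has_transitive_nilpotent_isometries (metric L).
Proof.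
exists (nil_group L), translate; split.
- exact: nilpotent_nil_group.
- split; [by move=> a b p; rewrite -translateA | exact: translate0p|].
  by move=> a b /(_ 0); rewrite !translatep0.
- exact: translate_isometry.
- move=> p q; exists (translate q (- p)).
  by rewrite -translateA translateNp translatep0.
Qed.

End NilGroup.

(** * Lengths of paths and completeness *)

Section RealCalculus.
Context {R : realType}.
Local Notation mu := (@lebesgue_measure R).
Implicit Types f s : R -> R.

Lemma continuous_integrable s a b :
  continuous s -> mu.-integrable `[a, b] (EFin \o s).
Proof.
move=> cs; apply: continuous_compact_integrable; first exact: segment_compact.
exact: continuous_subspaceT.
Qed.

Lemma unit_interval_measure : fine (mu `[0, 1]) = 1.
Proof.
by have /= := @lebesgue_measure_itv R `[0, 1]; rewrite lte_fin ltr01 oppr0 adde0 => ->.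
Qed.

(** The fundamental theorem of calculus, for a function whose derivative is
    dominated by the speed of a curve. *)
Lemma increment_le_integral f s (K t : R) :
  smooth f -> continuous s -> (forall x, 0 <= s x) -> 0 <= K ->
  (forall x, 0 <= x <= 1 -> `|f^`()%classic x| <= K * s x) ->
  0 <= t <= 1 ->
  `|f t - f 0| <= K * \int[mu]_(x in `[0, 1]) s x.
Proof.
move=> sf cs s0 K0 bf /andP[]; rewrite le_eqVlt => /predU1P[<- _|t0 t1].
  by rewrite subrr normr0 mulr_ge0// Rintegral_ge0.
have df x : derivable f x 1 by exact: smooth_derivable.
have cf : continuous f := sf 0%N.
have cf' : continuous f^`()%classic.
  have -> : f^`()%classic = 'D_1 f by apply/funext => x; exact: derive1E.
  exact: (sf 1%N).2.
have FTC : \int[mu]_(x in `[0, t]) f^`()%classic x = f t - f 0.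
  rewrite /Rintegral (@continuous_FTC2 _ _ f)//.
  - exact: continuous_subspaceT.
  - split=> //.
    + exact/cvg_at_right_filter/cf.
    + exact/cvg_at_left_filter/cf.
rewrite -FTC (le_trans (le_normr_Rintegral _ _))//; first exact: continuous_integrable.
have cKs : continuous (fun x => K * s x).
  by move=> x; apply: continuousM; [exact: cst_continuous | exact: cs].
apply: (@le_trans _ _ (\int[mu]_(x in `[0, t]) (K * s x))).
  apply: le_Rintegral => //.
  - apply: continuous_integrable => x; apply: continuous_comp; first exact: cf'.
    exact: norm_continuous.
  - exact: continuous_integrable.
  - move=> x; rewrite /= in_itv /= => /andP[x0 xt]; apply: bf.
    by rewrite x0 (le_trans xt).
rewrite RintegralZl//; last exact: continuous_integrable.
rewrite ler_wpM2l// -subr_ge0.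
rewrite Rintegral_itvB ?bnd_simp//; last 2 first.
- exact: continuous_integrable.
- exact: ltW.
exact: Rintegral_ge0.
Qed.

Lemma real_cauchy_cvg (a : nat -> R) :
  (forall e : R, 0 < e -> exists N, forall i j, (N <= i)%N -> (N <= j)%N ->
     `|a i - a j| < e) ->
  exists x, forall e : R, 0 < e -> exists N, forall i, (N <= i)%N -> `|a i - x| < e.
Proof.
move=> ca; have /cauchy_cvgP/cvg_ex[x ax] : cauchy (a @ \oo).
  apply: cauchy_exP => e e0; have [N aN] := ca e e0; exists (a N).
  by exists N => // j /= Nj; exact: aN.
exists x => e e0; move/cvgrPdist_lt : ax => /(_ e e0)[N _ aN].
by exists N => i Ni; rewrite distrC; exact: aN.
Qed.

End RealCalculus.

Section Paths.
Context {R : realType} {n : nat} (L : two_step R n).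
Local Notation V := 'cV[R]_n.+1.
Local Notation mu := (@lebesgue_measure R).
Implicit Types (p q u v : V) (gam : R -> V) (r l : R).

Definition speed gam t : R :=
  Num.sqrt (pairing (metric L (gam t)) (derive1 gam t) (derive1 gam t)).

Lemma derive1_coord gam i t : smooth gam ->
  (fun x => gam x i 0)^`()%classic t = derive1 gam t i 0.
Proof. by move=> sg; rewrite !derive1E derive_coord//; exact: smooth_derivable. Qed.

Lemma smooth_derive1 gam : smooth gam -> smooth (derive1 gam).
Proof.
move=> sg; have -> : derive1 gam = 'D_1 gam by apply/funext => t; exact: derive1E.
by move=> k; exact: (sg k.+1).2.
Qed.

Lemma continuous_speed gam : smooth gam -> continuous (speed gam).
Proof.
move=> sg t; apply: (@continuous_comp _ _ _ (fun t => pairing _ _ _) Num.sqrt); last first.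
  exact: sqrt_continuous.
suff sp : smooth (fun t => pairing (metric L (gam t)) (derive1 gam t) (derive1 gam t)).
  exact: sp 0%N t.
apply: (fun s => (smooth_mxP _).1 s 0 0); have sg' := smooth_derive1 sg.
apply: smooth_mulmx => //; apply: smooth_mulmx; first exact: smooth_trmx.
exact: smooth_metric.
Qed.

(** The components of the velocity in the orthonormal left-invariant frame are
    bounded by its length. *)
Lemma norm_coord_le_speed gam t i :
  `|(coframe L (gam t) *m derive1 gam t) i 0| <= speed gam t.
Proof.
rewrite /speed pairing_metric norm2E -sqrtr_sqr ler_wsqrtr//.
rewrite (bigD1 i)//= lerDl; apply: sumr_ge0 => j _; exact: sqr_ge0.
Qed.

Lemma segment_lengthE gam :
  segment_length (metric L) gam = \int[mu]_(t in `[0, 1]) speed gam t.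
Proof. by []. Qed.

Lemma segment_length_ge0 gam : 0 <= segment_length (metric L) gam.
Proof. by apply: Rintegral_ge0 => t _; exact: sqrtr_ge0. Qed.

Lemma path_length_ge0 p q l : path_length (metric L) p q l -> 0 <= l.
Proof.
by elim=> [//|gam q' l' _ _ IH]; rewrite addr_ge0// segment_length_ge0.
Qed.

Definition reach r p q := exists2 l, path_length (metric L) p q l & l <= r.

Lemma reach_le r r' p q : r <= r' -> reach r p q -> reach r' p q.
Proof. by move=> rr' [l pl lr]; exists l => //; exact: le_trans rr'. Qed.

Lemma reach_refl r p : 0 <= r -> reach r p p.
Proof. by move=> r0; exists 0 => //; exact: path_nil. Qed.

Lemma reach_trans r r' p q u : reach r p q -> reach r' q u -> reach (r + r') p u.
Proof.
move=> [l pl lr] [l' pl' lr']; exists (l + l'); last exact: lerD.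
elim: pl pl' {lr} => [q0|gam q0 l0 sg _ IH] pl'; first by rewrite add0r.
by rewrite -addrA; apply: path_cons => //; exact: IH.
Qed.

Definition norm2 v : R := Num.sqrt (\sum_i v i 0 ^+ 2).

Lemma norm2_le_sum v : norm2 v <= \sum_i `|v i 0|.
Proof.
have h0 : 0 <= \sum_i `|v i 0| by exact: sumr_ge0.
rewrite -[leRHS](ger0_norm h0) -sqrtr_sqr ler_wsqrtr//.
have : forall s : seq 'I_n.+1,
    0 <= \sum_(i <- s) `|v i 0| /\
    \sum_(i <- s) v i 0 ^+ 2 <= (\sum_(i <- s) `|v i 0|) ^+ 2.
  elim=> [|i s [s0 IH]]; first by rewrite !big_nil expr0n.
  rewrite !big_cons addr_ge0//; split=> //.
  by rewrite sqrrD -normrX ger0_norm ?sqr_ge0// -addrA lerD2l ler_wpDl// mulrn_wge0// mulr_ge0.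
by move=> /(_ (index_enum 'I_n.+1))[].
Qed.

(** The velocity of the segment from [p] to [q], expressed in the left-invariant
    frame, is constant: the segment is a translate of a one-parameter group. *)
Lemma reach_segment p q : reach (norm2 (coframe L p *m (q - p))) p q.
Proof.
pose gam t : V := p + t *: (q - p).
have sg : smooth gam.
  apply: smoothD; first exact: smooth_cst.
  by apply: smoothZ; [exact: smooth_id | exact: smooth_cst].
have dg t : derive1 gam t = q - p.
  rewrite derive1E /gam deriveD; [|exact: derivable_cst|]; last first.
    by apply/smooth_derivable/smoothZ; [exact: smooth_id | exact: smooth_cst].
  rewrite derive_cst add0r deriveE; last first.
    by apply/smooth_diff/smoothZ; [exact: smooth_id | exact: smooth_cst].
  rewrite diffZl; last exact: ex_diff.
  by rewrite diff_val scale1r.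
have sp t : speed gam t = norm2 (coframe L p *m (q - p)).
  rewrite /speed dg pairing_metric norm2E /norm2; congr Num.sqrt.
  apply: eq_bigr => i _; congr ((_ : V) i 0 ^+ 2).
  rewrite /coframe !mulmxBl [L (gam t)]linearD linearZ /= scalerDr mulmxDl.
  by rewrite -!scalemxAl ad_self !scaler0 addr0.
exists (segment_length (metric L) gam + 0).
  rewrite -[p in path_length _ p _](_ : gam 0 = p); last by rewrite /gam scale0r addr0.
  apply: path_cons => //; rewrite (_ : gam 1 = q); first exact: path_nil.
  by rewrite /gam scale1r addrC subrK.
rewrite addr0 segment_lengthE (_ : speed gam = cst (norm2 (coframe L p *m (q - p)))).
  by rewrite Rintegral_cst// unit_interval_measure mulr1.
exact/funext.
Qed.

Lemma path_nonempty p q : [set l | path_length (metric L) p q l] !=set0.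
Proof. by have [l pl _] := reach_segment p q; exists l. Qed.

Lemma riem_dist_le p q r : reach r p q -> riem_dist (metric L) p q <= r.
Proof.
move=> [l pl]; apply: le_trans; apply: ge_inf => //.
by exists 0 => l' /= /path_length_ge0.
Qed.

Lemma riem_dist_lt p q r : riem_dist (metric L) p q < r -> reach r p q.
Proof.
by move=> /inf_lt[|l pl /ltW lr]; [exact: path_nonempty | exists l].
Qed.

End Paths.

(** Coordinates in [deep] are those along the commutators: they are the ones on
    which [ad] takes its values and on which it does not depend. *)
Record grading (R : realType) n (L : two_step R n) := Grading {
  deep : pred 'I_n.+1;
  ad_norm : R;
  ad_norm_ge0 : 0 <= ad_norm;
  ad_shallow : forall (u v : 'cV[R]_n.+1) i, ~~ deep i -> (L u *m v) i 0 = 0;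
  ad_bound : forall (A B : R) (u v : 'cV[R]_n.+1),
    (forall j, ~~ deep j -> `|u j 0| <= A) ->
    (forall j, ~~ deep j -> `|v j 0| <= B) ->
    forall i, `|(L u *m v) i 0| <= ad_norm * A * B;
  deep_bracket : forall i, deep i -> exists j k,
    L (delta_mx j 0) *m delta_mx k 0 = delta_mx i 0 :> 'cV[R]_n.+1 }.

Section GradedPaths.
Context {R : realType} {n : nat} {L : two_step R n} (G : grading L).
Local Notation V := 'cV[R]_n.+1.
Local Notation mu := (@lebesgue_measure R).
Local Notation deep := (deep G).
Local Notation K := (ad_norm G).
Implicit Types (p q u v : V) (gam : R -> V) (r l A B : R).

Lemma coframe_shallow p v i : ~~ deep i -> (coframe L p *m v) i 0 = v i 0.
Proof.
move=> si; rewrite mulmxBl mul1mx -scalemxAl mxE [X in _ + X]mxE [X in - X]mxE.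
by rewrite (ad_shallow (g := G))// mulr0 subr0.
Qed.

Lemma segment_shallow gam i t : smooth gam -> ~~ deep i -> 0 <= t <= 1 ->
  `|gam t i 0 - gam 0 i 0| <= segment_length (metric L) gam.
Proof.
move=> sg si t01; rewrite segment_lengthE -[leRHS]mul1r.
have sgi : smooth (fun x => gam x i 0) by exact: (smooth_mxP _).1 sg i 0.
apply: (increment_le_integral sgi) => //; first exact: continuous_speed.
  by move=> x; exact: sqrtr_ge0.
move=> x _; rewrite mul1r derive1_coord// -(coframe_shallow (gam x) _ si).
exact: norm_coord_le_speed.
Qed.

(** A deep component of the coframe is the differential of the coordinate minus
    half the bracket with the position, so the derivative of a deep coordinate is
    bounded by the speed times a bound for the shallow coordinates. *)
Lemma segment_deep gam i A (l := segment_length (metric L) gam) :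
  smooth gam -> 0 <= A -> (forall j, ~~ deep j -> `|gam 0 j 0| <= A) ->
  `|gam 1 i 0 - gam 0 i 0| <= (1 + 2^-1 * (K * (A + l))) * l.
Proof.
move=> sg A0 gA; have l0 : 0 <= l := segment_length_ge0 L gam.
have K0 := ad_norm_ge0 G.
have sgi : smooth (fun x => gam x i 0) by exact: (smooth_mxP _).1 sg i 0.
have speed0 x : 0 <= speed L gam x by exact: sqrtr_ge0.
rewrite [X in _ * X]segment_lengthE.
apply: (increment_le_integral sgi) => //; [exact: continuous_speed | | |].
- by rewrite addr_ge0// mulr_ge0 ?invr_ge0// mulr_ge0// addr_ge0.
- move=> x x01; rewrite derive1_coord//.
  have -> : derive1 gam x = coframe L (gam x) *m derive1 gam x
      + 2^-1 *: (L (gam x) *m derive1 gam x).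
    by rewrite mulmxBl mul1mx -scalemxAl subrK.
  rewrite [X in `|X|]mxE (le_trans (ler_normD _ _))// mulrDl mul1r lerD//.
    exact: norm_coord_le_speed.
  rewrite [X in `|X|]mxE normrM ger0_norm ?invr_ge0// -mulrA ler_wpM2l ?invr_ge0//.
  apply: (ad_bound (g := G)) => j sj.
    rewrite -[gam x j 0](subrK (gam 0 j 0)) addrC (le_trans (ler_normD _ _))//.
    by rewrite lerD ?gA// segment_shallow.
  by rewrite -(coframe_shallow (gam x) _ sj); exact: norm_coord_le_speed.
- by rewrite ler01 lexx.
Qed.

Lemma path_shallow p q l i : path_length (metric L) p q l -> ~~ deep i ->
  `|q i 0 - p i 0| <= l.
Proof.
move=> + si; elim=> [q0|gam q0 l0 sg _ IH]; first by rewrite subrr normr0.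
rewrite -(subrKA (gam 1 i 0)) addrC (le_trans (ler_normD _ _))// lerD//.
by apply: segment_shallow => //; rewrite ler01 lexx.
Qed.

Lemma path_deep p q l i A : path_length (metric L) p q l -> 0 <= A ->
  (forall j, ~~ deep j -> `|p j 0| <= A) ->
  `|q i 0 - p i 0| <= (1 + 2^-1 * (K * (A + l))) * l.
Proof.
move=> pl; elim: pl A => [q0|gam q0 l0 sg pl IH] A A0 pA.
  by rewrite subrr normr0 mulr0.
set l1 := segment_length _ _; have l10 : 0 <= l1 := segment_length_ge0 L gam.
have l00 := path_length_ge0 pl; have K0 := ad_norm_ge0 G.
have h1 := segment_deep i sg A0 pA; rewrite -/l1 in h1.
have gA j : ~~ deep j -> `|gam 1 j 0| <= A + l1.
  move=> sj;
  rewrite -[gam 1 j 0](subrK (gam 0 j 0)) addrC (le_trans (ler_normD _ _))//.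
  by rewrite lerD ?pA// segment_shallow// ler01 lexx.
have h2 := IH (A + l1) (addr_ge0 A0 l10) gA.
rewrite -(subrKA (gam 1 i 0)) addrC (le_trans (ler_normD _ _))//.
rewrite (le_trans (lerD h1 h2))//.
have : 0 <= K * l0 * l1 by rewrite !mulr_ge0.
nra.
Qed.

(** Along a Cauchy sequence the shallow coordinates stay bounded, which makes
    the deep ones Lipschitz as well. *)
Lemma complete_metric_two_step : complete_metric (metric L).
Proof.
move=> u cu; have K0 := ad_norm_ge0 G.
have [N1 uN1] := cu 1 ltr01.
pose A := \sum_i `|u N1 i 0| + 1.
have A0 : 0 <= A by rewrite addr_ge0// sumr_ge0.
have uA i : (N1 <= i)%N -> forall j, ~~ deep j -> `|u i j 0| <= A.
  move=> Ni j sj; have [l pl l1] := riem_dist_lt (uN1 _ _ (leqnn _) Ni).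
  rewrite -[u i j 0](subrK (u N1 j 0)) addrC (le_trans (ler_normD _ _))// lerD//.
    by rewrite (bigD1 j)//= lerDl sumr_ge0.
  exact: le_trans (path_shallow pl sj) l1.
pose C := 1 + 2^-1 * (K * (A + 1)).
have C1 : 1 <= C by rewrite lerDl mulr_ge0 ?invr_ge0// mulr_ge0// addr_ge0.
have C0 : 0 < C by exact: lt_le_trans C1.
have lip i j r k : (N1 <= i)%N -> r <= 1 -> riem_dist (metric L) (u i) (u j) < r ->
    `|u j k 0 - u i k 0| <= C * r.
  move=> Ni r1 /riem_dist_lt[l pl lr]; have l0 := path_length_ge0 pl.
  apply: le_trans (path_deep k pl A0 (uA _ Ni)) _.
  apply: ler_pM => //; last first.
    by rewrite lerD2l ler_wpM2l ?invr_ge0// ler_wpM2l// lerD2l (le_trans lr).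
  by rewrite addr_ge0// mulr_ge0 ?invr_ge0// mulr_ge0// addr_ge0.
have : forall k, exists x, forall e : R, 0 < e -> exists N, forall i, (N <= i)%N ->
    `|u i k 0 - x| < e.
  move=> k; apply: real_cauchy_cvg => e e0.
  pose d := Num.min 1 (e / (2 * C)).
  have d0 : 0 < d by rewrite lt_min ltr01 divr_gt0// mulr_gt0.
  have [N uN] := cu d d0; exists (maxn N N1) => i j.
  rewrite !geq_max => /andP[Ni N1i] /andP[Nj N1j].
  have d1 : d <= 1 by rewrite ge_min lexx.
  have := lip _ _ d k N1j d1 (uN _ _ Nj Ni); move=> /le_lt_trans; apply.
  apply: (@le_lt_trans _ _ (C * (e / (2 * C)))).
    by rewrite ler_pM2l// ge_min lexx orbT.
  have -> : C * (e / (2 * C)) = e / 2 by field; rewrite gt_eqF.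
  lra.
move=> /choice[x ux]; pose p : V := \col_k x k.
exists p => e e0; pose S := n.+1%:R * C.
have S0 : 0 < S by rewrite mulr_gt0.
have : exists N, forall i k, (N <= i)%N -> `|u i k 0 - x k| < e / (2 * S).
  have h k := ux k (e / (2 * S)) (divr_gt0 e0 (mulr_gt0 (ltr0Sn _ 1) S0)).
  have /choice[N uN] := h; exists (\max_k N k) => i k Ni; apply: uN.
  by apply: leq_trans Ni; exact: leq_bigmax.
move=> [N uN]; exists (maxn N N1) => i; rewrite geq_max => /andP[Ni N1i].
apply: le_lt_trans (riem_dist_le (reach_segment L (u i) p)) _.
apply: le_lt_trans (norm2_le_sum _) _.
apply: (@le_lt_trans _ _ (\sum_(k < n.+1) (C * (e / (2 * S))))).
  apply: ler_sum => k _; rewrite mulmxBl mul1mx -scalemxAl [X in `|X|]mxE.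
  have dk k' : `|(p - u i) k' 0| <= e / (2 * S).
    by rewrite !mxE distrC; exact/ltW/uN.
  have eS : 0 <= e / (2 * S) by rewrite divr_ge0 ?ltW// mulr_gt0.
  rewrite (le_trans (ler_normD _ _))// [X in _ + `|X|]mxE [X in `|- X|]mxE.
  rewrite normrN [X in _ + X]normrM [`|2^-1|]ger0_norm ?invr_ge0// [X in _ <= X]mulrDl mul1r.
  rewrite lerD// -mulrA ler_wpM2l ?invr_ge0//.
  have := ad_bound (g := G) (uA _ N1i) (fun j _ => dk j) k; move=> /le_trans; apply.
  by rewrite ler_wpM2r// ler_wpM2l// lerDl.
have -> : \sum_(k < n.+1) (C * (e / (2 * S))) = e / 2; last by lra.
rewrite sumr_const card_ord -[LHS]mulr_natl (mulrA _ C) -/S; field.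
by rewrite gt_eqF.
Qed.

End GradedPaths.

(** * Growth as an isometry invariant *)

Lemma box_injection (I : finType) (a b : I -> nat) (f : (I -> nat) -> I -> nat) :
  (forall x, (forall i, x i < a i)%N -> forall i, (f x i < b i)%N) ->
  (forall x y, (forall i, x i < a i)%N -> (forall i, y i < a i)%N ->
     f x =1 f y -> x =1 y) ->
  (\prod_i a i <= \prod_i b i)%N.
Proof.
move=> fb finj.
have cardE (c : I -> nat) : #|{dffun forall i, 'I_(c i)}| = (\prod_i c i)%N.
  rewrite card_dep_ffun foldrE big_map big_enum /=.
  by apply: eq_bigr => i _; rewrite card_ord.
pose x_of (u : {dffun forall i, 'I_(a i)}) i : nat := u i.
have xa u i : (x_of u i < a i)%N by exact: ltn_ord.
pose F (u : {dffun forall i, 'I_(a i)}) : {dffun forall i, 'I_(b i)} :=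
  [ffun i => Ordinal (fb (x_of u) (xa u) i)].
rewrite -!cardE; apply: (@leq_card _ _ F) => u v /ffunP uv.
apply/ffunP => i; apply: val_inj; apply: (finj (x_of u) (x_of v)) => // j.
by have := congr1 val (uv j); rewrite !ffunE.
Qed.

Lemma absz_shift_lt (z : int) (k : nat) :
  `|z| <= k%:Z -> (absz (z + k%:Z)%R < (2 * k).+1)%N.
Proof. lia. Qed.

Lemma absz_shift_inj (z z' : int) (k : nat) :
  `|z| <= k%:Z -> `|z'| <= k%:Z -> absz (z + k%:Z) = absz (z' + k%:Z) -> z = z'.
Proof. lia. Qed.

Section Isometries.
Context {R : realType} {n : nat}.
Local Notation V := 'cV[R]_n.+1.
Implicit Types (g : V -> 'M[R]_n.+1) (phi psi : V -> V).

Lemma segment_length_isometry g g' phi gam : riem_isometry g g' phi -> smooth gam ->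
  segment_length g' (phi \o gam) = segment_length g gam.
Proof.
move=> [sphi _ iphi] sg; rewrite /segment_length; apply: eq_Rintegral => t _.
have -> : derive1 (phi \o gam) t = 'd phi (gam t) (derive1 gam t).
  by rewrite !derive1E derive_comp//; exact: smooth_diff.
by rewrite iphi.
Qed.

Lemma path_isometry g g' phi p q l : riem_isometry g g' phi ->
  path_length g p q l -> path_length g' (phi p) (phi q) l.
Proof.
move=> iphi; elim=> [p0|gam q0 l0 sg _ IH]; first exact: path_nil.
rewrite -(segment_length_isometry iphi sg).
apply: (path_cons (gamma := phi \o gam)) => //.
by apply: smooth_comp => //; case: iphi.
Qed.

Lemma riem_isometry_inv g g' phi : riem_isometry g g' phi ->
  exists2 psi, riem_isometry g' g psi & cancel phi psi.
Proof.
move=> [sphi [psi [spsi phiK psiK]] iphi]; exists psi => //.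
split=> // [|q v w]; first by exists phi.
have dK u : 'd phi (psi q) ('d psi q u) = u.
  have pp : phi \o psi = id by apply/funext => x; exact: psiK.
  have := derive_comp u (smooth_diff (psi q) sphi) (smooth_diff q spsi).
  by rewrite pp derive_id (deriveE u (smooth_diff q spsi)).
apply: etrans (esym (iphi (psi q) ('d psi q v) ('d psi q w))) _.
congr pairing; [congr g'; exact: psiK | exact: dK | exact: dK].
Qed.

End Isometries.

Section Reach.
Context {R : realType} {n : nat} (L : two_step R n).
Local Notation V := 'cV[R]_n.+1.
Implicit Types (p q v a : V) (r c s : R).

Lemma reach_translate a r p q : reach L r p q ->
  reach L r (translate L a p) (translate L a q).
Proof.
move=> [l pl lr]; exists l => //; exact: path_isometry (translate_isometry L a) pl.
Qed.

Lemma reach_right p v : reach L (\sum_i `|v i 0|) p (translate L p v).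
Proof.
apply: reach_le (reach_segment L _ _).
rewrite /translate addrAC subrr add0r mulmxA coframeK mul1mx.
exact: norm2_le_sum.
Qed.

Lemma reach_axis p s j : reach L `|s| p (translate L p (s *: delta_mx j 0)).
Proof.
apply: reach_le (reach_right p _); rewrite (bigD1 j)//= !mxE !eqxx mulr1.
rewrite big1 ?addr0// => i ij; rewrite !mxE (negbTE ij) mulr0 normr0//.
Qed.

Lemma commutatorE (a b : V) :
  translate L (translate L (translate L a b) (- a)) (- b) = L a *m b.
Proof.
have adN u v : L u *m (- v) = - (L u *m v) by exact: mulmxN.
have -> : translate L (translate L a b) (- a) = b + L a *m b.
  rewrite [LHS]translateE ad_translate translateE mulmxDl !adN ad_self (ad_anti L b).
  by move: (L a *m b) => c; apply/colP => i; rewrite !mxE; lra.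
rewrite translateE linearD /= ad_bracket addr0 adN ad_self.
by rewrite oppr0 scaler0 addr0 addrAC subrr add0r.
Qed.

(** The four sides of a square of side [s = sqrt c] in the directions [j] and [k]
    compose, by bilinearity, to a displacement by [s ^+ 2] along the commutator. *)
Lemma reach_commutator (i j k : 'I_n.+1) p c : 0 <= c ->
  L (delta_mx j 0) *m delta_mx k 0 = delta_mx i 0 :> V ->
  reach L (4 * Num.sqrt c) p (p + c *: delta_mx i 0).
Proof.
move=> c0 jk; set s := Num.sqrt c; have s0 : 0 <= s by exact: sqrtr_ge0.
pose a : V := s *: delta_mx j 0; pose b : V := s *: delta_mx k 0.
have aN x : - (s *: delta_mx x 0 : V) = (- s) *: delta_mx x 0 by rewrite scaleNr.
have -> : p + c *: delta_mx i 0 = translate L p (L a *m b).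
  rewrite translateE mulmxA ad_mul mul0mx scaler0 addr0 /a /b [L (_ *: _)]linearZ /=.
  by rewrite -scalemxAl -scalemxAr scalerA -expr2 sqr_sqrtr// jk.
have -> : 4 * s = s + s + s + s by ring.
rewrite -commutatorE !(translateA L p).
have step q (t : R) x : `|t| = s -> reach L s q (translate L q (t *: delta_mx x 0)).
  by move=> <-; exact: reach_axis.
have [ns ps] : `|- s| = s /\ `|s| = s by rewrite normrN ger0_norm.
rewrite [- a]aN [- b]aN; apply: reach_trans (step _ _ _ ns).
apply: reach_trans (step _ _ _ ns); apply: reach_trans (step _ _ _ ps).
exact: step.
Qed.

End Reach.

Section Growth.
Context {R : realType} {n : nat} {L : two_step R n} (G : grading L).
Local Notation V := 'cV[R]_n.+1.
Local Notation deep := (deep G).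
Local Notation K := (ad_norm G).
Implicit Types (p q v a : V) (r c s eps : R).

Definition homogeneous_weight (i : 'I_n.+1) : nat := (deep i).+1.
Local Notation w := homogeneous_weight.

Definition homogeneous_dim : nat := \sum_i w i.

(** The shallow part of [p] is reached first along a segment, and the deep
    coordinates are then added one at a time by commutators. *)
Lemma reach_box p (M : R) : 0 <= M ->
  (forall i, 0 <= p i 0 <= M ^+ w i) -> reach L (n.+1%:R * (4 * M)) 0 p.
Proof.
move=> M0 pM.
pose v : V := \sum_(i | ~~ deep i) p i 0 *: delta_mx i 0.
have pE : p = v + \sum_(i | deep i) p i 0 *: delta_mx i 0.
  rewrite {1}(matrix_sum_delta p) addrC (bigID deep) /=.
  by congr (_ + _); apply: eq_bigr => i _; rewrite big_ord1.
have -> : n.+1%:R * (4 * M) = \sum_(i | ~~ deep i) (4 * M) + \sum_(i | deep i) (4 * M).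
  have -> : n.+1%:R * (4 * M) = \sum_(i < n.+1) (4 * M).
    by rewrite sumr_const card_ord -[RHS]mulr_natl.
  by rewrite (bigID deep) addrC.
rewrite [X in reach _ _ _ X]pE; apply: (@reach_trans _ _ _ _ _ _ v).
  rewrite -(translate0p L v); apply: reach_le (reach_right L 0 v).
  have vE i : v i 0 = if ~~ deep i then p i 0 else 0.
    rewrite /v summxE; case: ifP => di.
      rewrite (bigD1 i)//= big1 ?addr0; first by rewrite !mxE !eqxx mulr1.
      by move=> j /andP[_ ji]; rewrite !mxE eq_sym (negbTE ji) mulr0.
    rewrite big1// => j dj; rewrite !mxE; case: eqP => [ij|_]; last by rewrite mulr0.
    by rewrite -ij di in dj.
  rewrite [leRHS]big_mkcond /=; apply: ler_sum => i _; rewrite vE.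
  case: ifPn => di; last by rewrite normr0.
  have /andP[p0 pM'] := pM i; rewrite ger0_norm// (le_trans pM')//.
  by rewrite /w (negbTE di) expr1 ler_peMl// ler1n.
move: (index_enum _) => s; elim: s v {pE} => [|i s IH] v.
  by rewrite !big_nil addr0; exact: reach_refl.
rewrite !big_cons; case: ifP => di; last exact: IH.
rewrite addrA; apply: reach_trans (IH _); have [j [k jk]] := deep_bracket di.
have /andP[p0 pM'] := pM i; apply: reach_le (reach_commutator v p0 jk).
by rewrite ler_pM2l// -[leRHS]ger0_norm// -sqrtr_sqr ler_wsqrtr//; rewrite /w di in pM'.
Qed.

Lemma deep_central (u v : V) : (forall j, ~~ deep j -> u j 0 = 0) -> L u *m v = 0.
Proof.
move=> u0; apply/colP => i; rewrite [RHS]mxE; apply/eqP; rewrite -normr_le0.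
pose B := \sum_j `|v j 0|.
have := @ad_bound _ _ _ G 0 B u v; rewrite mulr0 mul0r; apply=> j dj.
  by rewrite u0// normr0.
by rewrite /B (bigD1 j)//= lerDl sumr_ge0.
Qed.

(** Integral points joined by a path of length less than one have the same
    shallow coordinates; their difference is then central, and translating one
    of them to the origin bounds it by the length of a path from the origin. *)
Lemma reach_separated (a b : 'I_n.+1 -> nat) r : 0 <= r -> r < 1 ->
  (1 + 2^-1 * (K * r)) * r < 1 ->
  reach L r (\col_i (a i)%:R) (\col_i (b i)%:R) -> a =1 b.
Proof.
move=> r0 r1 Kr rab.
have eq_nat (x y : nat) : `|(y%:R : R) - x%:R| < 1 -> x = y.
  rewrite -[y%:R]/(y%:Z%:~R) -[x%:R]/(x%:Z%:~R) -intrB -intr_norm (_ : 1 = 1%:~R)//.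
  rewrite ltr_int; lia.
set p := \col_i _ in rab; set q := \col_i _ in rab.
have pqE i : q i 0 - p i 0 = (b i)%:R - (a i)%:R by rewrite !mxE.
have ab_shallow i : ~~ deep i -> a i = b i.
  move=> di; apply: eq_nat; rewrite -pqE; case: rab => l pl lr.
  exact: le_lt_trans (path_shallow pl di) (le_lt_trans lr r1).
have pq0 v : L (q - p) *m v = 0.
  by apply: deep_central => j /ab_shallow abj; rewrite !mxE abj subrr.
have [l] := reach_translate (- p) rab; rewrite translateNp.
have -> : translate L (- p) q = q - p.
  rewrite translateE linearN /= mulNmx -[q in L p *m q](subrK p) mulmxDr.
  by rewrite ad_self (ad_anti L p) pq0 oppr0 addr0 oppr0 scaler0 addr0 addrC.
move=> pl lr i; apply: eq_nat.
have z0 j : ~~ deep j -> `|(0 : V) j 0| <= 0 :> R by rewrite mxE normr0.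
have := path_deep i pl (lexx 0) z0; rewrite !mxE subr0 => h.
have l0 := path_length_ge0 pl; have K0 := ad_norm_ge0 G.
apply: le_lt_trans Kr; apply: le_trans h _; rewrite add0r ler_pM// ?addr_ge0 ?mulr_ge0 ?invr_ge0//.
by rewrite lerD2l ler_wpM2l ?invr_ge0// ler_wpM2l.
Qed.

(** Euclidean cubes far from the origin have a large diameter for the
    left-invariant metric.  The deep coordinates are therefore corrected, before
    rounding, by half the bracket with the rounded point [base], so that the
    diameter of a cell is bounded independently of its position. *)
Section Cells.
Variable eps : R.
Hypothesis eps_gt0 : 0 < eps.

Definition base q : V := \col_j (eps * (Num.floor (q j 0 / eps))%:~R).
Definition centered q : V := coframe L (base q) *m q.
Definition cell q (i : 'I_n.+1) : int := Num.floor (centered q i 0 / eps).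

Lemma floor_eq_dist (x y : R) :
  Num.floor (x / eps) = Num.floor (y / eps) -> `|x - y| <= eps.
Proof.
move=> xy; have := floor_le (x / eps); have := floorD1_gt (x / eps).
rewrite xy; have := floor_le (y / eps); have := floorD1_gt (y / eps).
rewrite intrD; set z := _%:~R => y1 y0 x1 x0.
have : `|x / eps - y / eps| <= 1 by rewrite ler_norml; lra.
by rewrite -mulrBl normrM [`|eps^-1|]gtr0_norm ?invr_gt0// ler_pdivrMr// mul1r.
Qed.

Lemma floor_dist (x : R) : `|x - eps * (Num.floor (x / eps))%:~R| <= eps.
Proof.
have := floor_le (x / eps); have := floorD1_gt (x / eps); rewrite intrD.
rewrite ltr_pdivrMr// ler_pdivlMr// => h1 h2; rewrite ler_norml; lra.
Qed.

Lemma centered_shallow q i : ~~ deep i -> centered q i 0 = q i 0.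
Proof. by move=> di; rewrite /centered (coframe_shallow _ _ di). Qed.

(** Two points of one cell have the same shallow coordinates of [base], hence the
    same correction; the displacement from [q] to [q'] in the left-invariant frame
    is then the difference of the corrected coordinates minus half its bracket
    with [q - base q], and the shallow coordinates of both are at most [eps]. *)
Lemma same_cell_reach q q' : cell q =1 cell q' ->
  reach L (n.+1%:R * ((1 + 2^-1 * (K * eps)) * eps)) q q'.
Proof.
move=> qq'; have K0 := ad_norm_ge0 G.
have flo j : ~~ deep j -> Num.floor (q j 0 / eps) = Num.floor (q' j 0 / eps).
  by move=> dj; have := qq' j; rewrite /cell !centered_shallow.
have bE v : L (base q') *m v = L (base q) *m v.
  apply/eqP; rewrite -subr_eq0 -mulmxBl -linearB /= deep_central// => j dj.
  by rewrite !mxE flo// subrr.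
have E : coframe L q *m (q' - q) =
    (centered q' - centered q) - 2^-1 *: (L (q - base q) *m (q' - q)).
  rewrite /centered /coframe !mulmxBl !mul1mx -!scalemxAl bE.
  rewrite [L (q - _)]linearB /= mulmxBl !mulmxBr ad_self.
  move: (L q *m q') (L (base q) *m q') (L (base q) *m q) => c1 c2 c3.
  by apply/colP => i; rewrite !mxE; lra.
apply: reach_le (reach_segment L q q'); rewrite E.
apply: le_trans (norm2_le_sum _) _.
apply: (@le_trans _ _ (\sum_(i < n.+1) ((1 + 2^-1 * (K * eps)) * eps))); last first.
  by rewrite sumr_const card_ord mulr_natl.
apply: ler_sum => i _; rewrite [X in `|X|]mxE mulrDl mul1r.
apply: le_trans (ler_normD _ _) _; apply: lerD.
  by rewrite [X in `|X|]mxE [X in _ + X]mxE; apply: floor_eq_dist; rewrite -[LHS]/(cell q' i) -qq'.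
rewrite [X in `|X|]mxE normrN [X in `|X|]mxE normrM [`|2^-1|]ger0_norm ?invr_ge0//.
rewrite -mulrA ler_wpM2l ?invr_ge0//; apply: (ad_bound (g := G)) => j dj.
  by rewrite !mxE; exact: floor_dist.
by rewrite !mxE; apply: floor_eq_dist; rewrite flo.
Qed.

Lemma cell_bound q r i : eps <= 1 -> 1 <= r -> reach L r 0 q ->
  `|(cell q i)%:~R| <= ((1 + 2 * K) / eps + 1) * r ^+ w i.
Proof.
move=> eps1 r1 [l pl lr]; have K0 := ad_norm_ge0 G.
have r0 : 0 <= r by exact: le_trans r1.
have l0 := path_length_ge0 pl.
have sh j : ~~ deep j -> `|q j 0| <= r.
  by move=> dj; have := path_shallow pl dj; rewrite mxE subr0 => /le_trans; apply.
have rw : 1 <= r ^+ w i by exact: exprn_ege1.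
have : `|centered q i 0| <= (1 + 2 * K) * r ^+ w i.
  have [di|di] := boolP (deep i); last first.
    rewrite centered_shallow// (le_trans (sh _ di))// /w (negbTE di) expr1.
    by rewrite ler_peMl// lerDl mulr_ge0.
  rewrite /centered /coframe mulmxBl mul1mx -scalemxAl [X in `|X|]mxE.
  apply: le_trans (ler_normD _ _) _.
  rewrite [X in _ + `|X|]mxE normrN [X in _ + `|X|]mxE normrM.
  rewrite [`|2^-1|]ger0_norm ?invr_ge0//.
  have h1 : `|q i 0| <= (1 + 2^-1 * (K * r)) * r.
    have z0 j : ~~ deep j -> `|(0 : V) j 0| <= 0 :> R by rewrite mxE normr0.
    have := path_deep i pl (lexx 0) z0; rewrite [X in _ - X]mxE subr0 => /le_trans; apply.
    rewrite add0r ler_pM// ?addr_ge0 ?mulr_ge0 ?invr_ge0//.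
    by rewrite lerD2l ler_wpM2l ?invr_ge0// ler_wpM2l.
  have h2 : `|(L (base q) *m q) i 0| <= K * (r + eps) * r.
    apply: (ad_bound (g := G)) => [j dj|]; last exact: sh.
    have := floor_dist (q j 0); rewrite mxE; set x := eps * _; have := sh j dj.
    by rewrite !ler_norml; lra.
  apply: le_trans (lerD h1 (ler_wpM2l _ h2)) _; first by rewrite invr_ge0.
  rewrite /w di; have r2 : r <= r ^+ 2 by rewrite expr2 ler_peMl.
  have : K * (r + eps) * r <= K * (2 * r ^+ 2).
    by rewrite -mulrA ler_wpM2l// expr2 mulrA ler_wpM2r//; lra.
  have : K * r ^+ 2 = K * r * r by rewrite expr2 mulrA.
  have : 0 <= K * r ^+ 2 by rewrite mulr_ge0// exprn_ge0.
  nra.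
move=> ce; rewrite mulrDl mul1r.
have : `|centered q i 0 / eps| <= (1 + 2 * K) / eps * r ^+ w i.
  rewrite normrM [`|eps^-1|]gtr0_norm ?invr_gt0// mulrAC ler_wpM2r// invr_ge0; exact: ltW.
rewrite /cell; have := floor_le (centered q i 0 / eps).
have := floorD1_gt (centered q i 0 / eps); rewrite intrD.
rewrite !ler_norml; lra.
Qed.

End Cells.
End Growth.

(** An isometry sends a lattice box of size [m ^+ w] to as many points of a
    ball of radius proportional to [m], no two of them in one cell of a fixed
    size; the number of such cells in the ball is [O(m ^ homogeneous_dim)]. *)
Lemma isometry_homogeneous_dim {R : realType} {n : nat} {L1 L2 : two_step R n}
    (G1 : grading L1) (G2 : grading L2) phi :
  riem_isometry (metric L1) (metric L2) phi ->
  (homogeneous_dim G1 <= homogeneous_dim G2)%N.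
Proof.
move=> iphi; have [psi ipsi phiK] := riem_isometry_inv iphi.
set K1 := ad_norm G1; set K2 := ad_norm G2.
have [K10 K20] : 0 <= K1 /\ 0 <= K2 by split; exact: ad_norm_ge0.
(* [d] separates integer points for the first metric, cells of size [eps] have
   diameter at most [d] for the second, and [T * m ^ w] bounds the rounded
   coordinates of the images. *)
pose d := (2 + K1)^-1.
have d0 : 0 < d by rewrite invr_gt0; lra.
have d2 : (2 + K1) * d = 1 by rewrite mulfV// gt_eqF//; lra.
have K1d : 0 <= K1 * d by rewrite mulr_ge0// ltW.
have d1 : d < 1 by lra.
have dsep : (1 + 2^-1 * (K1 * d)) * d < 1 by nra.
pose eps := d / (n.+1%:R * (1 + K2)).
have n0 : 1 <= n.+1%:R :> R by rewrite ler1n.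
have N0 : 0 < n.+1%:R * (1 + K2) by rewrite mulr_gt0//; lra.
have eps0 : 0 < eps by rewrite divr_gt0.
have epsE : n.+1%:R * (1 + K2) * eps = d.
  by rewrite /eps mulrC divfK// gt_eqF.
have eps1 : eps <= 1.
  rewrite /eps ler_pdivrMr// mul1r (le_trans (ltW d1))//.
  by rewrite mulr_ege1//; lra.
have epsd : n.+1%:R * ((1 + 2^-1 * (K2 * eps)) * eps) <= d.
  rewrite -epsE -mulrA ler_wpM2l ?ler0n// ler_wpM2r ?(ltW eps0)//.
  have : K2 * eps <= K2 by rewrite ler_piMr.
  have : 0 <= K2 * eps by rewrite mulr_ge0// ltW.
  lra.
pose D := (1 + 2 * K2) / eps + 1.
have D0 : 0 <= D by rewrite addr_ge0// divr_ge0 ?(ltW eps0)//; lra.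
pose c : R := n.+1%:R * 4.
have c1 : 1 <= c by rewrite mulr_ege1// ler1n.
pose T := (Num.truncn (D * c ^+ 2)).+1.
have TD : D * c ^+ 2 <= T%:R by apply/ltW/truncnS_gt.
rewrite leqNgt; apply/negP => dim.
(* With this [m], one more power of [m] beats the constant [(3 * T) ^ n.+1] of the
   count of cells. *)
pose m := ((3 * T) ^ n.+1).+1.
pose point (x : 'I_n.+1 -> nat) : 'cV[R]_n.+1 := \col_i (x i)%:R.
pose im x := translate L2 (- phi 0) (phi (point x)).
have fim0 x r : reach L1 r 0 (point x) -> reach L2 r 0 (im x).
  move=> [l pl lr]; rewrite -(translateNp L2 (phi 0)); apply: reach_translate.
  by exists l => //; exact: path_isometry iphi pl.
have back x y r : reach L2 r (im x) (im y) -> reach L1 r (point x) (point y).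
  move=> /(reach_translate (phi 0)); rewrite !translateA translatepN !translate0p.
  move=> [l pl lr]; exists l => //; rewrite -(phiK (point x)) -(phiK (point y)).
  exact: path_isometry ipsi pl.
have m1 : 1 <= m%:R :> R by rewrite ler1n.
pose wt2 := homogeneous_weight G2.
have cell_range x i : (forall j, (x j < m ^ homogeneous_weight G1 j)%N) ->
    `|cell (L := L2) eps (im x) i| <= (T * m ^ wt2 i)%:Z.
  move=> xm; rewrite -(ler_int R) intr_norm.
  have rx : reach L1 (c * m%:R) 0 (point x).
    rewrite /c -mulrA; apply: (@reach_box _ _ _ G1) => [|j]; first exact: ler0n.
    by rewrite mxE ler0n -natrX ler_nat ltnW.
  have := @cell_bound _ _ _ G2 eps eps0 (im x) (c * m%:R) i eps1 _ (fim0 _ _ rx).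
  rewrite mulr_ege1// => /(_ isT)/le_trans; apply.
  rewrite -/D exprMn mulrA -[X in _ <= X]/((T * m ^ wt2 i)%:R) natrM natrX.
  rewrite ler_wpM2r ?exprn_ge0// (le_trans _ TD)// ler_wpM2l//.
  by rewrite ler_weXn2l// /homogeneous_weight; case: (deep G2 i).
pose code x i := absz (cell (L := L2) eps (im x) i + (T * m ^ wt2 i)%:Z).
have : (\prod_i m ^ homogeneous_weight G1 i <= \prod_i (2 * T * m ^ wt2 i).+1)%N.
  apply: (@box_injection _ _ _ code) => [x xm i|x y xm ym xy].
    by rewrite -mulnA; apply: absz_shift_lt; exact: cell_range.
  have {}xy : cell (L := L2) eps (im x) =1 cell (L := L2) eps (im y).
    by move=> i; apply: absz_shift_inj (xy i); exact: cell_range.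
  apply: (reach_separated (G := G1) (ltW d0) d1 dsep).
  exact/back/(reach_le epsd)/(same_cell_reach G2 eps0).
apply/negP; rewrite -ltnNge.
have T1 : (0 < T)%N by [].
have prodE (w : 'I_n.+1 -> nat) : (\prod_i m ^ w i = m ^ (\sum_i w i))%N.
  by rewrite expn_sum.
apply: (@leq_ltn_trans (\prod_(i < n.+1) ((3 * T) * m ^ wt2 i))).
  apply: leq_prod => i _; have wpos : (0 < T * m ^ wt2 i)%N by rewrite muln_gt0 expn_gt0.
  by rewrite -!mulnA (mulnDl 2 1) mul1n -addn1 leq_add2l.
rewrite big_split /= !prodE prod_nat_const card_ord -/(homogeneous_dim G1).
rewrite -/(homogeneous_dim G2); apply: (@leq_trans (m ^ (homogeneous_dim G2).+1)).
  by rewrite (expnS m) ltn_pmul2r ?expn_gt0.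
by rewrite leq_exp2l// /m ltnS expn_gt0.
Qed.

(** * The three metrics *)

Section Concrete.
Context {R : realType}.
Local Notation V := 'cV[R]_8.
Implicit Types (u v p : V) (i j : 'I_8).

Definition unit_vec (k : nat) : V := delta_mx (inord k) 0.

Lemma x_D k u v : x_ k (u + v) = x_ k u + x_ k v.
Proof. by rewrite /x_ mxE. Qed.

Lemma x_Z k c u : x_ k (c *: u) = c * x_ k u.
Proof. by rewrite /x_ mxE. Qed.

Lemma coordE u i : u i 0 = x_ i.+1 u.
Proof. by rewrite /x_ /= inord_val. Qed.

Lemma x_unit k l : (k.-1 < 8)%N -> (l < 8)%N -> x_ k (unit_vec l) = (k.-1 == l)%:R.
Proof. by move=> k8 l8; rewrite /x_ /unit_vec mxE andbT -val_eqE /= !inordK. Qed.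

Lemma dx_mul k v : (dx k *m v) 0 0 = x_ k v.
Proof. by rewrite /dx /x_ -rowE mxE. Qed.

Lemma rows_mul (f : 'I_8 -> 'rV[R]_8) v i :
  ((\matrix_k f k) *m v) i 0 = (f i *m v) 0 0.
Proof. by rewrite -[f i](rowK f) -row_mul [RHS]mxE. Qed.

Lemma row_mulD (a b : 'rV[R]_8) v : ((a + b) *m v) 0 0 = (a *m v) 0 0 + (b *m v) 0 0.
Proof. by rewrite mulmxDl mxE. Qed.

Lemma row_mulN (a : 'rV[R]_8) v : ((- a) *m v) 0 0 = - (a *m v) 0 0.
Proof. by rewrite mulNmx mxE. Qed.

Lemma row_mulZ c (a : 'rV[R]_8) v : ((c *: a) *m v) 0 0 = c * (a *m v) 0 0.
Proof. by rewrite -scalemxAl mxE. Qed.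

Lemma row_mul0 v : ((0 : 'rV[R]_8) *m v) 0 0 = 0.
Proof. by rewrite mul0mx mxE. Qed.

Definition row_mulE := (row_mulD, row_mulN, row_mulZ, row_mul0, dx_mul).

Lemma alpha1_mul u v : (alpha1 u *m v) 0 0 =
  x_ 1 u * x_ 2 v - x_ 2 u * x_ 1 v - x_ 3 u * x_ 4 v + x_ 4 u * x_ 3 v.
Proof. by rewrite /alpha1 !row_mulE. Qed.

Lemma alpha2_mul u v : (alpha2 u *m v) 0 0 =
  x_ 1 u * x_ 3 v - x_ 3 u * x_ 1 v + x_ 2 u * x_ 4 v - x_ 4 u * x_ 2 v.
Proof. by rewrite /alpha2 !row_mulE. Qed.

Lemma alpha3_mul u v : (alpha3 u *m v) 0 0 =
  x_ 1 u * x_ 4 v - x_ 4 u * x_ 1 v - x_ 2 u * x_ 3 v + x_ 3 u * x_ 2 v.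
Proof. by rewrite /alpha3 !row_mulE. Qed.

Lemma ip_coords u v : ip u v =
  x_ 1 u * x_ 1 v + x_ 2 u * x_ 2 v + x_ 3 u * x_ 3 v + x_ 4 u * x_ 4 v
  + x_ 5 u * x_ 5 v + x_ 6 u * x_ 6 v + x_ 7 u * x_ 7 v + x_ 8 u * x_ 8 v.
Proof.
rewrite /ip mxE (eq_bigr (fun i => x_ i.+1 u * x_ i.+1 v)) => [|i _].
  by rewrite !big_ord_recl big_ord0 /= addr0 !addrA.
by rewrite mxE !coordE.
Qed.

(** The three metrics belong to one family, indexed by which of the three
    coordinates [y_1], [y_2], [y_3] are twisted. *)
Section Family.
Variables c1 c2 c3 : bool.

Definition twist (u : V) (k : nat) : 'rV[R]_8 :=
  match k with
  | 4 => c1%:R *: alpha1 u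
  | 5 => c2%:R *: alpha2 u
  | 6 => c3%:R *: alpha3 u
  | _ => 0
  end.

Definition twist_ad (u : V) : 'M[R]_8 := \matrix_i twist u i.

Lemma twist_ad_linear : linear twist_ad.
Proof.
move=> a u v; apply/matrixP => i j; rewrite !mxE.
case: i => -[|[|[|[|[|[|[|i]]]]]]] i8; rewrite /= !(x_D, x_Z, mxE); ring.
Qed.

HB.instance Definition _ :=
  GRing.isLinear.Build R V 'M[R]_8 _ twist_ad twist_ad_linear.

Definition twist_br u v (k : nat) : R :=
  match k with
  | 4 => c1%:R * (x_ 1 u * x_ 2 v - x_ 2 u * x_ 1 v - x_ 3 u * x_ 4 v + x_ 4 u * x_ 3 v)
  | 5 => c2%:R * (x_ 1 u * x_ 3 v - x_ 3 u * x_ 1 v + x_ 2 u * x_ 4 v - x_ 4 u * x_ 2 v)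
  | 6 => c3%:R * (x_ 1 u * x_ 4 v - x_ 4 u * x_ 1 v - x_ 2 u * x_ 3 v + x_ 3 u * x_ 2 v)
  | _ => 0
  end.

Lemma twist_adE u v i : (twist_ad u *m v) i 0 = twist_br u v i.
Proof.
rewrite rows_mul; case: i => -[|[|[|[|[|[|[|i]]]]]]] i8 /=;
  by rewrite !row_mulE ?(alpha1_mul, alpha2_mul, alpha3_mul).
Qed.

Lemma x_twist u v k : (0 < k <= 8)%N -> x_ k (twist_ad u *m v) = twist_br u v k.-1.
Proof. by case: k => // k k8; rewrite /x_ twist_adE inordK. Qed.

Lemma twist_self u : twist_ad u *m u = 0.
Proof.
apply/colP => i; rewrite twist_adE mxE.
by case: i => -[|[|[|[|[|[|[|i]]]]]]] i8 //=; ring.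
Qed.

Lemma twist_bracket u v : twist_ad (twist_ad u *m v) = 0.
Proof.
apply: mulmx_ext => z; apply/colP => i; rewrite twist_adE mul0mx mxE.
by case: i => -[|[|[|[|[|[|[|i]]]]]]] i8 //=; rewrite !x_twist//=; ring.
Qed.

Definition twist_two_step : two_step R 7 := TwoStep twist_self twist_bracket.

Definition twist_deep (i : 'I_8) : bool :=
  match val i with 4 => c1 | 5 => c2 | 6 => c3 | _ => false end.

Lemma twist_shallow u v i : ~~ twist_deep i -> (twist_ad u *m v) i 0 = 0.
Proof.
rewrite twist_adE /twist_deep; case: i => -[|[|[|[|[|[|[|i]]]]]]] i8 //= /negbTE ->;
  by rewrite mul0r.
Qed.

Lemma x_shallow k u A : (0 < k <= 4)%N ->
  (forall j, ~~ twist_deep j -> `|u j 0| <= A) -> `|x_ k u| <= A.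
Proof.
move=> k4 uA; apply: uA; rewrite /twist_deep /= inordK; last by lia.
by case: k k4 => [|[|[|[|[|k]]]]].
Qed.

Lemma norm_mul_le (x y A B : R) : `|x| <= A -> `|y| <= B -> `|x * y| <= A * B.
Proof. by move=> xA yB; rewrite normrM ler_pM. Qed.

Lemma norm_flag_le (c : bool) (a b d e M : R) :
  `|a| <= M -> `|b| <= M -> `|d| <= M -> `|e| <= M ->
  `|c%:R * (a + b + d + e)| <= 4 * M.
Proof. by rewrite !ler_norml; case: c => /=; lra. Qed.

Lemma twist_bound (A B : R) u v :
  (forall j, ~~ twist_deep j -> `|u j 0| <= A) ->
  (forall j, ~~ twist_deep j -> `|v j 0| <= B) ->
  forall i, `|(twist_ad u *m v) i 0| <= 4 * A * B.
Proof.
move=> uA vB i; have xu k : (0 < k <= 4)%N -> `|x_ k u| <= A by move=> ?; exact: x_shallow.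
have xv k : (0 < k <= 4)%N -> `|x_ k v| <= B by move=> ?; exact: x_shallow.
have AB0 : 0 <= 4 * A * B.
  rewrite -mulrA mulr_ge0// mulr_ge0//.
    exact: le_trans (normr_ge0 _) (xu 1%N isT).
  exact: le_trans (normr_ge0 _) (xv 1%N isT).
rewrite twist_adE -mulrA in AB0 *; case: i => -[|[|[|[|[|[|[|i]]]]]]] i8 /=;
  rewrite ?normr0//; apply: norm_flag_le; rewrite ?normrN; apply: norm_mul_le;
  by [exact: xu | exact: xv].
Qed.

Lemma twist_deep_bracket i : twist_deep i -> exists j k,
  twist_ad (delta_mx j 0) *m delta_mx k 0 = delta_mx i 0 :> V.
Proof.
move=> di; pose k : nat := match val i with 4 => 1%N | 5 => 2%N | _ => 3%N end.
exists (inord 0), (inord k); apply/colP => l.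
rewrite twist_adE -![delta_mx (inord _) 0]/(unit_vec _) mxE andbT -val_eqE /=.
move: di; rewrite /twist_deep /k; case: i {k} => -[|[|[|[|[|[|[|i]]]]]]] i8 //= ci;
  case: l => -[|[|[|[|[|[|[|[|l]]]]]]]] l8 //=; rewrite ?ci ?x_unit//=; ring.
Qed.

Definition twist_grading : grading twist_two_step :=
  @Grading R 7 twist_two_step twist_deep 4 (ler0n _ 4) twist_shallow twist_bound
    twist_deep_bracket.

Lemma homogeneous_dim_twist : homogeneous_dim twist_grading = (8 + (c1 + c2 + c3))%N.
Proof.
rewrite /homogeneous_dim !big_ord_recl big_ord0 /homogeneous_weight /= /twist_deep /=.
lia.
Qed.

(** Left multiplications by the unit quaternions [i] and [j] on both copies of
    the quaternions; the forms [d alpha_k] are anti-self-dual, hence invariant. *)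
Definition quat_i : 'M[R]_8 := \matrix_(k < 8)
  nth 0 [:: - dx 2; dx 1; - dx 4; dx 3; - dx 6; dx 5; - dx 8; dx 7] k.
Definition quat_j : 'M[R]_8 := \matrix_(k < 8)
  nth 0 [:: - dx 3; dx 4; dx 1; - dx 2; - dx 7; dx 8; dx 5; - dx 6] k.

Definition quat_i_coords v : seq R :=
  [:: - x_ 2 v; x_ 1 v; - x_ 4 v; x_ 3 v; - x_ 6 v; x_ 5 v; - x_ 8 v; x_ 7 v].
Definition quat_j_coords v : seq R :=
  [:: - x_ 3 v; x_ 4 v; x_ 1 v; - x_ 2 v; - x_ 7 v; x_ 8 v; x_ 5 v; - x_ 6 v].

Lemma quat_iE v i : (quat_i *m v) i 0 = nth 0 (quat_i_coords v) i.
Proof.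
by rewrite rows_mul; case: i => -[|[|[|[|[|[|[|[|i]]]]]]]] i8 //=; rewrite !row_mulE.
Qed.

Lemma quat_jE v i : (quat_j *m v) i 0 = nth 0 (quat_j_coords v) i.
Proof.
by rewrite rows_mul; case: i => -[|[|[|[|[|[|[|[|i]]]]]]]] i8 //=; rewrite !row_mulE.
Qed.

Lemma x_quat_i k v : (0 < k <= 8)%N -> x_ k (quat_i *m v) = nth 0 (quat_i_coords v) k.-1.
Proof. by case: k => // k k8; rewrite /x_ quat_iE inordK. Qed.

Lemma x_quat_j k v : (0 < k <= 8)%N -> x_ k (quat_j *m v) = nth 0 (quat_j_coords v) k.-1.
Proof. by case: k => // k k8; rewrite /x_ quat_jE inordK. Qed.

Lemma isometry_orthogonal (A : 'M[R]_8) :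
  (forall u v, ip (A *m u) (A *m v) = ip u v) -> A^T *m A = 1%:M.
Proof.
move=> Aip; apply: mulmx_ext => v; apply/colP => i.
by rewrite -!ip_delta ipC -mulmxA ip_trmx Aip ipC mul1mx.
Qed.

Lemma quat_i_hermitian : left_hermitian twist_two_step quat_i.
Proof.
split=> [||u v].
- apply: mulmx_ext => u; apply/colP => i; rewrite -mulmxA quat_iE mulNmx mul1mx mxE.
  by rewrite coordE; case: i => -[|[|[|[|[|[|[|[|i]]]]]]]] i8 //=; rewrite x_quat_i.
- apply: isometry_orthogonal => u v; rewrite !ip_coords !x_quat_i//=; ring.
- apply/colP => i; rewrite !twist_adE.
  by case: i => -[|[|[|[|[|[|[|[|i]]]]]]]] i8 //=; rewrite !x_quat_i//=; ring.
Qed.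

Lemma quat_j_hermitian : left_hermitian twist_two_step quat_j.
Proof.
split=> [||u v].
- apply: mulmx_ext => u; apply/colP => i; rewrite -mulmxA quat_jE mulNmx mul1mx mxE.
  by rewrite coordE; case: i => -[|[|[|[|[|[|[|[|i]]]]]]]] i8 //=; rewrite x_quat_j//= opprK.
- apply: isometry_orthogonal => u v; rewrite !ip_coords !x_quat_j//=; ring.
- apply/colP => i; rewrite !twist_adE.
  by case: i => -[|[|[|[|[|[|[|[|i]]]]]]]] i8 //=; rewrite !x_quat_j//=; ring.
Qed.

Lemma quat_anticommute : quat_i *m quat_j = - (quat_j *m quat_i).
Proof.
apply: mulmx_ext => u; apply/colP => i; rewrite mulNmx -!mulmxA [RHS]mxE quat_iE quat_jE.
by case: i => -[|[|[|[|[|[|[|[|i]]]]]]]] i8 //=; rewrite x_quat_i// x_quat_j//= opprK.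
Qed.

Lemma twist_weak_HKT : [|| c1, c2 | c3] ->
  exists J1 J2 J3, weak_HKT J1 J2 J3 (metric twist_two_step).
Proof.
move=> c123; apply: (@left_weak_HKT _ _ twist_two_step quat_i quat_j
  (unit_vec 0) (unit_vec 1) (unit_vec 2) (unit_vec 3)).
- exact: quat_i_hermitian.
- exact: quat_j_hermitian.
- exact: quat_anticommute.
rewrite !ip_coords !x_twist//= !x_unit//=.
by case: c1 c2 c3 c123 => [] [] []//= _; apply/eqP; lra.
Qed.

Lemma metric_rows (A : 'M[R]_8) : A^T *m A = \sum_i sq (row i A).
Proof.
apply/matrixP => a b; rewrite mxE summxE; apply: eq_bigr => i _.
by rewrite !mxE big_ord1 !mxE.
Qed.

Lemma metric_twistE p : metric twist_two_step p =
  \sum_(i < 8) sq (dx i.+1 - 2^-1 *: twist p i).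
Proof.
rewrite /metric metric_rows; apply: eq_bigr => i _; congr sq.
rewrite /coframe linearB /= linearZ /= row1 rowK.
by rewrite /dx /= inord_val.
Qed.

End Family.

Lemma g1E : g1 = metric (twist_two_step true false false).
Proof.
apply/funext => p; rewrite metric_twistE !big_ord_recl big_ord0.
rewrite /g1 /index_iota /= !big_cons !big_nil /= !scale0r !scaler0 !subr0 scale1r !addr0 !addrA.
by [].
Qed.

Lemma g2E : g2 = metric (twist_two_step false true true).
Proof.
apply/funext => p; rewrite metric_twistE !big_ord_recl big_ord0.
rewrite /g2 /index_iota /= !big_cons !big_nil /= !scale0r !scaler0 !subr0 !scale1r !addr0 !addrA.
by [].
Qed.

Lemma g3E : g3 = metric (twist_two_step true true true).
Proof.
apply/funext => p; rewrite metric_twistE !big_ord_recl big_ord0.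
rewrite /g3 /index_iota /= !big_cons !big_nil /= !scaler0 !subr0 !scale1r !addr0 !addrA.
by [].
Qed.

Lemma isometric_twist (c1 c2 c3 d1 d2 d3 : bool) :
  isometric (metric (twist_two_step c1 c2 c3)) (metric (twist_two_step d1 d2 d3)) ->
  (c1 + c2 + c3 = d1 + d2 + d3)%N.
Proof.
move=> [phi iphi]; have [psi ipsi _] := riem_isometry_inv iphi.
have := isometry_homogeneous_dim (twist_grading c1 c2 c3) (twist_grading d1 d2 d3) iphi.
have := isometry_homogeneous_dim (twist_grading d1 d2 d3) (twist_grading c1 c2 c3) ipsi.
by rewrite !homogeneous_dim_twist !leq_add2l => dc cd; apply/eqP; rewrite eqn_leq cd dc.
Qed.

End Concrete.

Theorem mainTheorem5 (R : realType) :
  [/\ (exists J1 J2 J3 : 'cV[R]_8 -> 'M[R]_8, weak_HKT J1 J2 J3 g1),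
      (exists J1 J2 J3 : 'cV[R]_8 -> 'M[R]_8, weak_HKT J1 J2 J3 g2)
    & (exists J1 J2 J3 : 'cV[R]_8 -> 'M[R]_8, weak_HKT J1 J2 J3 g3)] /\
  [/\ has_transitive_nilpotent_isometries (@g1 R),
      has_transitive_nilpotent_isometries (@g2 R)
    & has_transitive_nilpotent_isometries (@g3 R)] /\
  [/\ complete_metric (@g1 R), complete_metric (@g2 R)
    & complete_metric (@g3 R)] /\
  [/\ ~ isometric (@g1 R) (@g2 R), ~ isometric (@g1 R) (@g3 R)
    & ~ isometric (@g2 R) (@g3 R)].
Proof.
rewrite g1E g2E g3E; split; first by split; exact: twist_weak_HKT.
split; first by split; exact: transitive_metric.
split; first by split; exact: complete_metric_two_step (twist_grading _ _ _).
by split=> /isometric_twist.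
Qed.
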